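(* Suppose $M \subset \mathbb{C}^n$ is a CR singular real-analytic submanifold of (real) codimension $2$ near zero, defined by $w=\rho(z,\bar{z})$ in coordinates $(z,w)\in\mathbb{C}^{n-1}\times\mathbb{C}$, where $\rho$ is real-analytic (complex-valued) and vanishes to order at least $2$ at $0$. Suppose that $N$ is a real-analytic generic submanifold of $\mathbb{C}^n$ and $F$ is a holomorphic map of a neighborhood of $N$ into $\mathbb{C}^n$ such that $F|_N\colon N \to \mathbb{C}^n$ is a diffeomorphism onto $M$. If $\rho(0,\bar{z}) \equiv 0$, then $F$ cannot be a finite map: the germ of $F$ at the point of $N$ that is mapped to $0$ is not finite.
   Context: $n \ge 2$. For a real submanifold $M \subset \mathbb{C}^n$ of real codimension $d$ and $q \in M$, $T^{0,1}_qM$ denotes the space of antiholomorphic vectors in $\mathbb{C}\otimes T_q\mathbb{C}^n$ that are tangent to $M$. $M$ is generic at $p$ if $\dim_{\mathbb{C}} T^{0,1}_qM = n-d$ for all $q \in M$ near $p$, and generic if it is generic at every point. $M$ is a CR singular submanifold if the function $q \mapsto \dim_{\mathbb{C}} T^{0,1}_qM$ has points of discontinuity (the CR singular points). In $\rho(z,\bar z)$ the variables $z$ and $\bar z$ are treated as independent variables in the convergent power series of $\rho$ at $0$; $\rho(0,\bar z)$ is the series obtained by setting $z=0$ while keeping $\bar z$. A germ at $a \in \mathbb{C}^n$ of a holomorphic map $F=(F_1,\dots,F_n)$ is finite if $\dim_{\mathbb{C}} \mathcal{O}_a/\mathcal{I}(F) < \infty$, where $\mathcal{O}_a$ is the ring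 of germs of holomorphic functions at $a$ and $\mathcal{I}(F)$ is the ideal generated by $F_1-F_1(a),\dots,F_n-F_n(a)$. *)

(* Defs.v *)
From HB Require Import structures.
From mathcomp Require Import all_boot all_order all_algebra.
From mathcomp Require Import all_classical all_reals all_analysis.
From mathcomp Require Export complex.

Set Implicit Arguments.
Unset Strict Implicit.
Unset Printing Implicit Defensive.

Import Order.TTheory GRing.Theory Num.Theory.
Import numFieldNormedType.Exports.

Local Open Scope classical_set_scope.
Local Open Scope ring_scope.

(* The complex numbers R[i], typed as a numClosedFieldType so that R[i] and
   'rV[R[i]]_n get their topology and norm from MathComp-Analysis; the norm
   of 'rV[CC R]_n is the maximum of the moduli of the coordinates. *)
Definition CC (R : realType) : numClosedFieldType := R[i].

Definition rc (R : realType) (t : R) : CC R := (t%:C)%C.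

Section power_series.
Context {R : realType}.
Local Notation C := (CC R).

(* A power series in n variables is given by its coefficients, indexed by
   the multi-indices a = (a_0, ..., a_{n-1}). *)
Definition mpseries (n : nat) : Type := {ffun 'I_n -> nat} -> C.

(* Partial sum over the box {a | a_j < N for all j}. *)
Definition psum n (c : mpseries n) (x : 'rV[C]_n) (N : nat) : C :=
  \sum_(a : {ffun 'I_n -> 'I_N})
    c [ffun j => nat_of_ord (a j)] * \prod_j x 0 j ^+ a j.

Definition abs_convergent n (c : mpseries n) (r : R) : Prop :=
  exists B : R, forall N,
    psum (fun a => `|c a|) (const_mx (rc r)) N <= rc B.

Definition has_pseries n (c : mpseries n) (f : 'rV[C]_n -> C) (a : 'rV[C]_n)
    : Prop :=
  exists r : R, [/\ 0 < r, abs_convergent c r &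
    forall x : 'rV[C]_n, `|x| < rc r -> psum c x @ \oo --> f (a + x)].

Definition holomorphic_at n (f : 'rV[C]_n -> C) (a : 'rV[C]_n) : Prop :=
  exists c : mpseries n, has_pseries c f a.

Definition conj_row n (x : 'rV[C]_n) : 'rV[C]_n := map_mx Num.conj x.

(* f(a + z) is the sum of a power series in the 2n variables (z, zbar): in
   'I_(n + n) the first n indices are those of z, the last n those of zbar. *)
Definition has_zzbar_series n (c : mpseries (n + n)) (f : 'rV[C]_n -> C)
    (a : 'rV[C]_n) : Prop :=
  exists r : R, [/\ 0 < r, abs_convergent c r &
    forall z : 'rV[C]_n, `|z| < rc r ->
      psum c (row_mx z (conj_row z)) @ \oo --> f (a + z)].

Definition real_analytic_at n (f : 'rV[C]_n -> C) (a : 'rV[C]_n) : Prop :=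
  exists c : mpseries (n + n), has_zzbar_series c f a.

Definition order_ge n (c : mpseries n) (k : nat) : Prop :=
  forall a : {ffun 'I_n -> nat}, (\sum_j a j < k)%N -> c a = 0.

(* The series c(0, zbar), in the n variables zbar. *)
Definition set_z0 n (c : mpseries (n + n)) : mpseries n :=
  fun b => c [ffun j => match fintype.split j with inl _ => 0%N | inr k => b k end].

End power_series.

Section smooth_maps.
Context {R : realType}.
Local Notation C := (CC R).

Definition rdiffquot n m (f : 'rV[C]_n -> 'rV[C]_m) (x v : 'rV[C]_n) (h : R)
  : 'rV[C]_m := rc (h^-1) *: (f (x + rc h *: v) - f x).

(* The derivative of f at x in the real direction v (increment h is real). *)
Definition rderivable n m (f : 'rV[C]_n -> 'rV[C]_m) (x v : 'rV[C]_n) : Prop :=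
  cvg (rdiffquot f x v h @[h --> 0^']).

Definition rderive n m (f : 'rV[C]_n -> 'rV[C]_m) (x v : 'rV[C]_n) : 'rV[C]_m :=
  lim (rdiffquot f x v h @[h --> 0^']).

Fixpoint Ck n m (k : nat) (U : set 'rV[C]_n) (f : 'rV[C]_n -> 'rV[C]_m) : Prop :=
  (forall x, U x -> {for x, continuous f}) /\
  match k with
  | 0 => True
  | k'.+1 => forall v : 'rV[C]_n,
      (forall x, U x -> rderivable f x v) /\ Ck k' U (fun x => rderive f x v)
  end.

Definition smooth n m (U : set 'rV[C]_n) (f : 'rV[C]_n -> 'rV[C]_m) : Prop :=
  forall k, Ck k U f.

Definition smooth_on_subset n m (S : set 'rV[C]_n) (f : 'rV[C]_n -> 'rV[C]_m)
    : Prop :=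
  forall q, S q -> exists (U : set 'rV[C]_n) (g : 'rV[C]_n -> 'rV[C]_m),
    [/\ open U, U q, smooth U g & forall x, S x -> U x -> g x = f x].

Definition diffeomorphism_onto n m (N : set 'rV[C]_n) (M : set 'rV[C]_m)
    (F : 'rV[C]_n -> 'rV[C]_m) : Prop :=
  [/\ set_bij N M F, smooth_on_subset N F &
    exists G : 'rV[C]_m -> 'rV[C]_n,
      (forall x, N x -> G (F x) = x) /\ smooth_on_subset M G].

End smooth_maps.

Section submanifolds.
Context {R : realType}.
Local Notation C := (CC R).

(* dr_x(v) for a real-valued function r. *)
Definition rdifferential n (r : 'rV[C]_n -> R) (x v : 'rV[C]_n) : R :=
  derive1 (fun t : R => r (x + rc t *: v)) 0.

(* Embedded real-analytic submanifold of C^n of real codimension d. *)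
Definition analytic_submanifold n (d : nat) (M : set 'rV[C]_n) : Prop :=
  forall p, M p -> exists (U : set 'rV[C]_n) (r : 'I_d -> 'rV[C]_n -> R),
    [/\ open U, U p,
        forall k x, U x -> real_analytic_at (fun y => rc (r k y)) x,
        forall x, U x -> (M x <-> forall k, r k x = 0) &
        forall x, U x -> forall l : 'I_d -> R,
          (forall v, \sum_k l k * rdifferential (r k) x v = 0) ->
          forall k, l k = 0].

(* T_qM, as velocities of curves in M; T_qC^n is identified with C^n, the
   tangent vector of z = x + iy being dx/dt + i dy/dt. *)
Definition tangent n (M : set 'rV[C]_n) (q : 'rV[C]_n) : set 'rV[C]_n :=
  [set u | exists gamma : R -> 'rV[C]_n,
    [/\ gamma 0 = q, \forall t \near (0 : R), M (gamma t) &
        rc (t^-1) *: (gamma t - q) @[t --> (0 : R)^'] --> u]].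

(* The real vector u is sum_j u_j d/dz_j + conj(u_j) d/dzbar_j, so a general
   element X + iY of the complexification of T_qM, with X and Y in T_qM, has
   d/dz-coefficients X + iY and d/dzbar-coefficients conj X + i conj Y.  It is
   antiholomorphic when the former vanish; the latter are then its coordinates
   in the basis d/dzbar_j. *)
Definition T01 n (M : set 'rV[C]_n) (q : 'rV[C]_n) : set 'rV[C]_n :=
  [set a | exists X Y : 'rV[C]_n,
    [/\ tangent M q X, tangent M q Y, X + 'i *: Y = 0 &
        conj_row X + 'i *: conj_row Y = a]].

(* The largest number of linearly independent vectors in V, i.e. the complex
   dimension of V when V is a subspace. *)
Definition cdim n (V : set 'rV[C]_n) : nat :=
  \max_(k < n.+1 |
    `[< exists A : 'M[C]_(k, n), row_free A /\ forall i, V (row i A) >]) k.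

Definition dimT01 n (M : set 'rV[C]_n) (q : 'rV[C]_n) : nat := cdim (T01 M q).

(* M is generic of real codimension d: dim T01 = n - d at every point. *)
Definition generic n (d : nat) (M : set 'rV[C]_n) : Prop :=
  forall q, M q -> (dimT01 M q + d = n)%N.

Definition CR_singular_point n (M : set 'rV[C]_n) (q : 'rV[C]_n) : Prop :=
  M q /\ ~ (dimT01 M x @[x --> within M (nbhs q)] --> dimT01 M q).

Definition CR_singular n (M : set 'rV[C]_n) : Prop :=
  exists q, CR_singular_point M q.

End submanifolds.

Section finite_germs.
Context {R : realType}.
Local Notation C := (CC R).

(* Elements of O_a are represented by functions holomorphic at a, two of them
   being the same germ when they agree near a. *)

(* The germ of f at a lies in I(F), generated by the F_j - F_j(a). *)
Definition in_germ_ideal n m (F : 'rV[C]_n -> 'rV[C]_m) (a : 'rV[C]_n)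
    (f : 'rV[C]_n -> C) : Prop :=
  exists u : 'I_m -> 'rV[C]_n -> C,
    (forall j, holomorphic_at (u j) a) /\
    \forall x \near a, f x = \sum_j u j x * (F x 0 j - F a 0 j).

(* dim O_a / I(F) < oo: finitely many germs span O_a modulo I(F). *)
Definition finite_germ n m (F : 'rV[C]_n -> 'rV[C]_m) (a : 'rV[C]_n) : Prop :=
  exists (k : nat) (g : 'I_k -> 'rV[C]_n -> C),
    (forall i, holomorphic_at (g i) a) /\
    forall h, holomorphic_at h a -> exists l : 'I_k -> C,
      in_germ_ideal F a (fun x => h x - \sum_i l i * g i x).

End finite_germs.

(* Main.v *)
Require Import Defs.
From HB Require Import structures.
From mathcomp Require Import all_boot all_order all_algebra.
From mathcomp Require Import all_classical all_reals all_analysis.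
From mathcomp Require Import ring lra.
Import Order.TTheory GRing.Theory Num.Theory.
Import numFieldNormedType.Exports.
Local Open Scope classical_set_scope.
Local Open Scope ring_scope.

(** The map F restricts to a diffeomorphism of N onto the graph M of rho near 0,
    so over each complex line s |-> s e of the z-space there is a smooth lift
    h(s) in N with h(0) = p and F(h(s)) = (s e, rho(s e)).

    Finiteness of F at p constrains the expansion of h in (s, conj s).  Some
    nonzero polynomial q satisfies q(x_i - p_i) = sum_j w_j F_j near p.  Pull this
    identity back by h and set s = 0 in the Taylor expansions while keeping
    conj s: each F_j(h) is s e_j or rho(s e), and both disappear, the second one
    because rho(0, conj z) = 0.  As formal power series form a domain, the part
    of h_i - p_i free of s is zero; its linear term suffices here
    (finite_germ_no_conj_part).  Thus h(s) = p + s A + O(|s|^2), and the whole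
    complex line of A is tangent to N at p.  Letting e run through a basis gives
    m independent complex lines in the tangent space, whence dim T^{0,1}_p N >= m
    (le_dimT01), and genericity forces the real codimension d of N to be at most 1.

    But N has the dimension of M, so d <= 1 is absurd.  Concretely, the
    differential D of the z-coordinates of F at p kills a nonzero vector w.  If
    d <= 1, some nonzero complex multiple v of w is approximately tangent to N
    (complex_line_tangent).  This contradicts the fact that the inverse of F on
    M is Lipschitz and M is a graph over the z-space, which bounds |x| by the
    z-coordinates of F(p + x) when p + x is in N (no_approx_tangent).

    The inverse of F on M is a smooth map, so the expansions of h are finite Taylor
    expansions, taken modulo O(|s|^k), with polynomials in two independent letters
    for s and conj s.  That the part free of s is well defined is ev_small_coef0;
    that a smooth map has such expansions along a curve which has them is
    smooth_jet, which rests on the Taylor formula proved in taylor. *)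

Set Implicit Arguments.
Unset Strict Implicit.
Unset Printing Implicit Defensive.

(** * Real-valued norms *)

Section real_norm.
Context {R : realType}.
Local Notation C := (CC R).

HB.instance Definition _ := GRing.RMorphism.copy (@rc R) (real_complex R).

(** The norm takes values in the partially ordered field CC R; its real part is
    the same number in R, where bounds can be compared and minimised. *)
Definition nr {V : normedModType C} (x : V) : R := complex.Re `|x|.

Lemma rc_nr (V : normedModType C) (x : V) : rc (nr x) = `|x|.
Proof.
rewrite /rc /nr; apply/eqP; rewrite eq_complex /= eqxx /=.
by rewrite (@ger0_Im R `|x|) // normr_ge0.
Qed.

Lemma ler_rc (a b : R) : (rc a <= rc b) = (a <= b).
Proof. exact: lecR. Qed.

Lemma ltr_rc (a b : R) : (rc a < rc b) = (a < b).
Proof. exact: ltcR. Qed.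

Lemma nr_ge0 (V : normedModType C) (x : V) : 0 <= nr x.
Proof. by rewrite -ler_rc rc_nr rmorph0 normr_ge0. Qed.

Lemma nr0 (V : normedModType C) : nr (0 : V) = 0.
Proof. by rewrite /nr normr0. Qed.

Lemma nr_eq0 (V : normedModType C) (x : V) : (nr x == 0) = (x == 0).
Proof. by rewrite -[RHS]normr_eq0 -rc_nr fmorph_eq0. Qed.

Lemma nrN (V : normedModType C) (x : V) : nr (- x) = nr x.
Proof. by rewrite /nr normrN. Qed.

Lemma nr_distC (V : normedModType C) (x y : V) : nr (x - y) = nr (y - x).
Proof. by rewrite -nrN opprB. Qed.

Lemma ler_nrD (V : normedModType C) (x y : V) : nr (x + y) <= nr x + nr y.
Proof. by rewrite -ler_rc rmorphD /= !rc_nr ler_normD. Qed.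

Lemma nrM (x y : C) : nr (x * y) = nr x * nr y.
Proof. by apply: (fmorph_inj (@rc R)); rewrite rmorphM /= !rc_nr normrM. Qed.

Lemma nrX (x : C) k : nr (x ^+ k) = nr x ^+ k.
Proof. by apply: (fmorph_inj (@rc R)); rewrite rmorphXn /= !rc_nr normrX. Qed.

Lemma nrZ (V : normedModType C) (a : C) (x : V) : nr (a *: x) = nr a * nr x.
Proof. by apply: (fmorph_inj (@rc R)); rewrite rmorphM /= !rc_nr normrZ. Qed.

Lemma nr_rc (a : R) : nr (rc a) = `|a|.
Proof. by rewrite /nr normc_def /= expr0n addr0 sqrtr_sqr. Qed.

Lemma nr1 : nr (1 : C) = 1.
Proof. by rewrite -(rmorph1 (@rc R)) nr_rc normr1. Qed.

Lemma nr_i : nr ('i : C) = 1.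
Proof. by apply: (fmorph_inj (@rc R)); rewrite rmorph1 /= rc_nr normCi. Qed.

Lemma nr_conj (x : C) : nr (x^*) = nr x.
Proof. by rewrite /nr norm_conjC. Qed.

Lemma ler_Re_nr (x : C) : `|complex.Re x| <= nr x.
Proof. by rewrite -ler_rc rc_nr; exact: normc_ge_Re. Qed.

Lemma nr_sum (V : normedModType C) I (s : seq I) (P : pred I) (f : I -> V) :
  nr (\sum_(i <- s | P i) f i) <= \sum_(i <- s | P i) nr (f i).
Proof.
elim/big_ind2 : _ => [|x a y b xa yb|//]; first by rewrite nr0.
by rewrite (le_trans (ler_nrD _ _))// lerD.
Qed.

Lemma nr_coord n (x : 'rV[C]_n) j : nr (x 0 j) <= nr x.
Proof.
rewrite -ler_rc !rc_nr [leRHS]/Num.norm /= /mx_norm.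
by rewrite -[leLHS]nngE num_le; exact: (le_bigmax _ _ (ord0, j)).
Qed.

Lemma nr_rV_le n (x : 'rV[C]_n) (b : R) : 0 <= b ->
  (forall j, nr (x 0 j) <= b) -> nr x <= b.
Proof.
move=> b0 xb; have [->|x0] := eqVneq x 0; first by rewrite nr0.
have := @mx_norm_neq0 _ _ _ x.
case=> [|[i j] xE].
  by apply: contra x0 => /eqP /mx_norm_eq0 ->.
rewrite -ler_rc rc_nr [leLHS]/Num.norm /= xE /= ord1 -rc_nr ler_rc.
exact: xb.
Qed.

(** Neighbourhoods by balls of real radius, based at the point itself: every
    estimate is centred at 0 after a translation. *)
Lemma nearP_at (V : normedModType C) (a : V) (P : V -> Prop) :
  (\forall x \near a, P x) <-> exists2 e : R, 0 < e & forall x, nr x < e -> P (a + x).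
Proof.
split=> [/nbhs_normP[e /= e0 eP]|[e e0 eP]].
  have eR : e = rc (complex.Re e).
    by apply/eqP; rewrite eq_complex /= eqxx /= ger0_Im // ltW.
  exists (complex.Re e).
    by rewrite -ltr_rc rmorph0 -eR.
  move=> x xe; apply: eP => /=.
  by rewrite opprD addNKr normrN -rc_nr eR ltr_rc.
apply/nbhs_normP; exists (rc e) => /=.
  by rewrite -(rmorph0 (@rc R)) ltr_rc.
move=> x; rewrite /= -rc_nr ltr_rc nr_distC => /eP.
by rewrite addrC subrK.
Qed.

Lemma near0P (V : normedModType C) (P : V -> Prop) :
  (\forall x \near 0, P x) <-> exists2 e : R, 0 < e & forall x, nr x < e -> P x.
Proof.
by rewrite nearP_at; split=> -[e e0 eP]; exists e => // x /eP; rewrite add0r.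
Qed.

End real_norm.

(** * Order of vanishing at the origin *)

Section bigO.
Context {R : realType}.
Local Notation C := (CC R).

(** f x = O(|x|^k) as x tends to 0.  The bound includes x = 0, so that for k > 0
    it forces f 0 = 0. *)
Definition isO (V W : normedModType C) (k : nat) (f : V -> W) : Prop :=
  exists2 B : R, 0 <= B & \forall x \near (0 : V), nr (f x) <= B * nr x ^+ k.

Implicit Types (V W X : normedModType C).

Lemma isO_near V W k (f g : V -> W) :
  (\forall x \near (0 : V), f x = g x) -> isO k f -> isO k g.
Proof.
move=> fg [B B0 fB]; exists B => //; near=> x.
have <- : f x = g x by near: x.
by near: x.
Unshelve. all: by end_near. Qed.

Lemma isO_le V W W' k (f : V -> W) (g : V -> W') :
  (forall x, nr (g x) <= nr (f x)) -> isO k f -> isO k g.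
Proof.
move=> gf [B B0 fB]; exists B => //; near=> x.
by apply: (le_trans (gf x)); near: x.
Unshelve. all: by end_near. Qed.

Lemma isO_ext V W k (f g : V -> W) : f =1 g -> isO k f -> isO k g.
Proof. by move=> fg; apply: isO_le => x; rewrite fg. Qed.

Lemma near_nr_lt V (e : R) : 0 < e -> \forall x \near (0 : V), nr x < e.
Proof. by move=> e0; apply/near0P; exists e. Qed.

Lemma isO_weaken V W j k (f : V -> W) : (j <= k)%N -> isO k f -> isO j f.
Proof.
move=> jk [B B0 fB]; exists B => //; near=> x.
have /le_trans : nr (f x) <= B * nr x ^+ k by near: x.
apply.
have x1 : nr x < 1 by near: x; apply: near_nr_lt.
by rewrite ler_wpM2l// ler_wiXn2l ?nr_ge0 // ltW.
Unshelve. all: by end_near. Qed.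

Lemma isO0 V W k : isO k (fun _ : V => 0 : W).
Proof. by exists 0 => //; apply: nearW => x; rewrite nr0 mul0r. Qed.

Lemma isO_cst V W (c : W) : isO 0 (fun _ : V => c).
Proof.
exists (nr c); first exact: nr_ge0.
by apply: nearW => x; rewrite expr0 mulr1.
Qed.

Lemma isO_id V : isO 1 (fun x : V => x).
Proof. by exists 1 => //; apply: nearW => x; rewrite expr1 mul1r. Qed.

Lemma isO_add V W k (f g : V -> W) :
  isO k f -> isO k g -> isO k (fun x => f x + g x).
Proof.
move=> [B B0 fB] [D D0 gD]; exists (B + D); first by rewrite addr_ge0.
near=> x; rewrite (le_trans (ler_nrD _ _))// mulrDl lerD//; near: x; [exact: fB|exact: gD].
Unshelve. all: by end_near. Qed.

Lemma isO_opp V W k (f : V -> W) : isO k f -> isO k (fun x => - f x).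
Proof. by apply: isO_le => x; rewrite nrN. Qed.

Lemma isO_sub V W k (f g : V -> W) :
  isO k f -> isO k g -> isO k (fun x => f x - g x).
Proof. by move=> fk gk; apply: isO_add => //; exact: isO_opp. Qed.

Lemma isO_trans V W k (f g h : V -> W) : isO k (fun x => f x - g x) ->
  isO k (fun x => g x - h x) -> isO k (fun x => f x - h x).
Proof.
move=> fg gh; have := isO_add fg gh.
by apply: isO_le => x; rewrite addrA subrK.
Qed.

Lemma isO_sum V W k I (s : seq I) (P : pred I) (f : I -> V -> W) :
  (forall i, P i -> isO k (f i)) -> isO k (fun x => \sum_(i <- s | P i) f i x).
Proof.
move=> fk; elim: s => [|i s IH].
  by apply: isO_le (isO0 V W k) => x; rewrite big_nil.
have [Pi|nPi] := boolP (P i).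
  apply: isO_le (isO_add (fk _ Pi) IH) => x; by rewrite big_cons Pi.
by apply: isO_le IH => x; rewrite big_cons (negbTE nPi).
Qed.

Lemma isO_scale V W j k (f : V -> C) (g : V -> W) :
  isO j f -> isO k g -> isO (j + k) (fun x => f x *: g x).
Proof.
move=> [B B0 fB] [D D0 gD]; exists (B * D); first by rewrite mulr_ge0.
near=> x; rewrite nrZ exprD mulrACA ler_pM ?nr_ge0//; near: x; [exact: fB|exact: gD].
Unshelve. all: by end_near. Qed.

Lemma isO_mul V j k (f g : V -> C) :
  isO j f -> isO k g -> isO (j + k) (fun x => f x * g x).
Proof. exact: isO_scale. Qed.

Lemma isO_near_comp V W (u : V -> W) (P : W -> Prop) :
  isO 1 u -> (\forall y \near (0 : W), P y) -> \forall x \near (0 : V), P (u x).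
Proof.
move=> [B B0 uB] /near0P[e e0 eP]; near=> x; apply: eP.
have uBx : nr (u x) <= B * nr x ^+ 1 by near: x.
rewrite (le_lt_trans uBx)// expr1.
have xe : nr x < e / (B + 1) by near: x; apply: near_nr_lt; rewrite divr_gt0 // ltr_wpDl.
rewrite (@le_lt_trans _ _ ((B + 1) * nr x)) ?ler_wpM2r ?nr_ge0 ?lerDl//.
by rewrite mulrC -ltr_pdivlMr// ltr_wpDl.
Unshelve. all: by end_near. Qed.

Lemma isO_comp V W X k (f : W -> X) (u : V -> W) :
  isO 1 u -> isO k f -> isO k (fun x => f (u x)).
Proof.
move=> u1 [D D0 fD]; have fuD := isO_near_comp u1 fD.
have [B B0 uB] := u1.
exists (D * B ^+ k); first by rewrite mulr_ge0 ?exprn_ge0.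
near=> x.
have fux : nr (f (u x)) <= D * nr (u x) ^+ k by near: x.
have ux : nr (u x) <= B * nr x ^+ 1 by near: x.
rewrite expr1 in ux; rewrite (le_trans fux)// -mulrA ler_wpM2l// -exprMn.
by rewrite lerXn2r ?nnegrE ?mulr_ge0 ?nr_ge0.
Unshelve. all: by end_near. Qed.

Lemma isO_coord V n k (f : V -> 'rV[C]_n) :
  (forall j, isO k (fun x => f x 0 j : C)) <-> isO k f.
Proof.
split=> [fk|fk j]; last by apply: isO_le fk => x; exact: nr_coord.
have /boolp.choice[B BP] : forall j, exists b : R, 0 <= b /\
    \forall x \near (0 : V), nr (f x 0 j : C) <= b * nr x ^+ k.
  by move=> j; have [b b0 fb] := fk j; exists b.
exists (\sum_j B j); first by rewrite sumr_ge0// => j _; have [] := BP j.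
have : \forall x \near (0 : V), forall j, nr (f x 0 j : C) <= B j * nr x ^+ k.
  by apply: filter_forall => j; have [] := BP j.
apply: filterS => x xB; apply: nr_rV_le.
  by rewrite mulr_ge0 ?exprn_ge0 ?nr_ge0 ?sumr_ge0// => j _; have [] := BP j.
move=> j; rewrite (le_trans (xB j))// ler_wpM2r ?exprn_ge0 ?nr_ge0//.
by rewrite (bigD1 j)//= lerDl sumr_ge0// => i _; have [] := BP i.
Qed.

Lemma isO_near0 V W k (f : V -> W) : isO k.+1 f -> f 0 = 0.
Proof.
move=> [B _ /near0P[e e0 /(_ 0)]]; rewrite nr0 => /(_ e0).
rewrite expr0n mulr0 => f0; apply/eqP; rewrite -nr_eq0.
by rewrite eq_le f0 nr_ge0.
Qed.

(** Divide by |s|: the norm of c is at most B |s| for arbitrarily small s. *)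
Lemma isO_line_eq0 V (c : V) : isO 2 (fun s : C => s *: c) -> c = 0.
Proof.
move=> [B B0 /near0P[e e0 cB]].
apply/eqP; rewrite -nr_eq0; apply/negP => /negP c0.
have {}c0 : 0 < nr c by rewrite lt0r c0 nr_ge0.
pose t := Num.min (e / 2) (nr c / (2 * (B + 1))).
have t0 : 0 < t by rewrite lt_min !divr_gt0 ?mulr_gt0// ltr_wpDl.
have := cB (rc t); rewrite nrZ !nr_rc (gtr0_norm t0) => /(_ _)/wrap[].
  by rewrite gt_min; apply/orP; left; rewrite ltr_pdivrMr// ltr_pMr// ltr1n.
rewrite mulrC expr2 mulrA ler_pM2r// => cBt.
have : t <= nr c / (2 * (B + 1)) by rewrite ge_min lexx orbT.
rewrite ler_pdivlMr; last by rewrite mulr_gt0// ltr_wpDl.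
nra.
Qed.

End bigO.

(** * Jets in a complex variable and its conjugate *)

Section jets.
Context {R : realType}.
Local Notation C := (CC R).
Implicit Types (Q : {poly {poly C}}) (phi psi : C -> C).

(** Q is a polynomial in two independent letters, the outer one standing for s
    and the inner one for the conjugate of s.  Hence Q`_0, the part free of s,
    is what remains of the series when s is set to 0 and its conjugate is kept. *)
Definition ev Q (s : C) : C := Q.[s%:P].[s^*].

Lemma evC (p : {poly C}) s : ev p%:P s = p.[s^*].
Proof. by rewrite /ev hornerC. Qed.

Lemma evX s : ev 'X s = s.
Proof. by rewrite /ev hornerX hornerC. Qed.

Lemma evD Q1 Q2 s : ev (Q1 + Q2) s = ev Q1 s + ev Q2 s.
Proof. by rewrite /ev !hornerD. Qed.

Lemma evM Q1 Q2 s : ev (Q1 * Q2) s = ev Q1 s * ev Q2 s.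
Proof. by rewrite /ev !hornerM. Qed.

Lemma evB Q1 Q2 s : ev (Q1 - Q2) s = ev Q1 s - ev Q2 s.
Proof. by rewrite /ev !hornerD !hornerN. Qed.

Lemma isO_conj : isO 1 (fun s : C => s^* : C).
Proof. by apply: isO_le (isO_id C) => x; rewrite nr_conj. Qed.

Lemma isO_horner (p : {poly C}) : isO 0 (fun s : C => p.[s^*] : C).
Proof.
elim/poly_ind: p => [|p c IH].
  by apply: isO_le (isO0 C C 0) => s; rewrite horner0.
have : isO 0 (fun s : C => p.[s^*] * s^* + c).
  apply: isO_add (isO_cst _ _).
  exact: isO_mul IH (isO_weaken (leq0n 1) isO_conj).
by apply: isO_le => s; rewrite hornerMXaddC.
Qed.

Lemma isO_ev Q : isO 0 (ev Q).
Proof.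
elim/poly_ind: Q => [|Q c IH].
  by apply: isO_le (isO0 C C 0) => s; rewrite /ev !horner0.
have : isO 0 (fun s : C => ev Q s * s + c.[s^*]).
  apply: isO_add (isO_horner _).
  exact: isO_mul IH (isO_weaken (leq0n 1) (isO_id _)).
by apply: isO_le => s; rewrite evD evM evX evC.
Qed.

(** phi(s) agrees with Q(s, conj s) up to O(|s|^k).  Only orders below k carry
    information, but keeping a whole polynomial makes Q |-> Q`_0 a ring morphism
    on the nose, without truncations. *)
Definition jet k phi Q := isO k (fun s : C => phi s - ev Q s).

Lemma jet_bounded k phi Q : jet k phi Q -> isO 0 phi.
Proof.
move=> /(isO_weaken (leq0n k)) /isO_add /(_ (isO_ev Q)).
by apply: isO_le => s; rewrite subrK.
Qed.

Lemma jet_ev k Q : jet k (ev Q) Q.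
Proof. by apply: isO_le (isO0 C C k) => s; rewrite subrr. Qed.

Lemma jet_near k phi psi Q : (\forall s \near (0 : C), phi s = psi s) ->
  jet k phi Q -> jet k psi Q.
Proof.
move=> e; apply: isO_near; near=> s; congr (_ - _); near: s.
Unshelve. all: by end_near.
Qed.

Lemma jet_trans k phi psi Q : isO k (fun s => phi s - psi s) ->
  jet k psi Q -> jet k phi Q.
Proof. exact: isO_trans. Qed.

Lemma jet_ext k phi psi Q : phi =1 psi -> jet k phi Q -> jet k psi Q.
Proof. by move=> e; apply: (@jet_near k phi psi Q); near=> s; exact: e. Unshelve. all: by end_near. Qed.

Lemma jet_cst k c : jet k (fun=> c) c%:P%:P.
Proof. by apply: jet_ext (jet_ev k _) => s; rewrite evC hornerC. Qed.

Lemma jet_id k : jet k id 'X.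
Proof. by apply: jet_ext (jet_ev k _) => s; rewrite evX. Qed.

Lemma jet_conj_id k : jet k (fun s => s^*) 'X%:P.
Proof. by apply: jet_ext (jet_ev k _) => s; rewrite evC hornerX. Qed.

Lemma jet_add k phi psi Q1 Q2 : jet k phi Q1 -> jet k psi Q2 ->
  jet k (fun s => phi s + psi s) (Q1 + Q2).
Proof.
move=> h1 h2; apply: isO_le (isO_add h1 h2) => s.
by rewrite evD opprD addrACA.
Qed.

Lemma jet_mul k phi psi Q1 Q2 : jet k phi Q1 -> jet k psi Q2 ->
  jet k (fun s => phi s * psi s) (Q1 * Q2).
Proof.
move=> h1 h2; have h1' := isO_mul h1 (jet_bounded h2).
rewrite addn0 in h1'.
apply: isO_ext (isO_add h1' (isO_mul (isO_ev Q1) h2)) => s.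
by rewrite evM; ring.
Qed.

Lemma jet_exp k phi Q n : jet k phi Q -> jet k (fun s => phi s ^+ n) (Q ^+ n).
Proof.
move=> h; elim: n => [|n IH].
  by rewrite expr0; apply: jet_ext (jet_cst k 1).
by rewrite exprS; apply: jet_ext (jet_mul h IH) => s; rewrite exprS.
Qed.

Lemma jet_sum k I (r : seq I) (P : pred I) (phi : I -> C -> C)
    (Q : I -> {poly {poly C}}) :
  (forall i, P i -> jet k (phi i) (Q i)) ->
  jet k (fun s => \sum_(i <- r | P i) phi i s) (\sum_(i <- r | P i) Q i).
Proof.
move=> h; elim: r => [|i r IH].
  by rewrite big_nil; apply: jet_ext (jet_cst k 0) => s; rewrite big_nil.
rewrite big_cons; case: ifPn => Pi.
  by apply: jet_ext (jet_add (h _ Pi) IH) => s; rewrite big_cons Pi.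
by apply: jet_ext IH => s; rewrite big_cons (negbTE Pi).
Qed.

Lemma jet_prod k I (r : seq I) (P : pred I) (phi : I -> C -> C)
    (Q : I -> {poly {poly C}}) :
  (forall i, P i -> jet k (phi i) (Q i)) ->
  jet k (fun s => \prod_(i <- r | P i) phi i s) (\prod_(i <- r | P i) Q i).
Proof.
move=> h; elim: r => [|i r IH].
  by rewrite big_nil; apply: jet_ext (jet_cst k 1) => s; rewrite big_nil.
rewrite big_cons; case: ifPn => Pi.
  by apply: jet_ext (jet_mul (h _ Pi) IH) => s; rewrite big_cons Pi.
by apply: jet_ext IH => s; rewrite big_cons (negbTE Pi).
Qed.

Lemma jet_horner k (q : {poly C}) phi Q : jet k phi Q ->
  jet k (fun s => q.[phi s]) (map_poly (polyC \o polyC) q).[Q].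
Proof.
move=> h; elim/poly_ind: q => [|q c IH].
  by rewrite map_poly0 horner0; apply: jet_ext (jet_cst k 0) => s; rewrite horner0.
rewrite rmorphD rmorphM /= map_polyX map_polyC /= hornerMXaddC.
by apply: jet_ext (jet_add (jet_mul IH h) (jet_cst k c)) => s; rewrite hornerMXaddC.
Qed.

(** Conjugating exchanges the two letters and conjugates the coefficients. *)
Lemma ev_conj Q : exists Q', forall s, ev Q' s = (ev Q s)^*.
Proof.
elim/poly_ind: Q => [|Q c [Q' QE]].
  by exists 0 => s; rewrite /ev !horner0 rmorph0.
exists (Q' * 'X%:P + map_poly (polyC \o Num.conj) c) => s.
rewrite !evD !evM QE !evC hornerX evX rmorphD rmorphM /=; congr (_ + _).
rewrite /ev.
elim/poly_ind: c => [|p c IH].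
  by rewrite map_poly0 !horner0 rmorph0.
rewrite rmorphD rmorphM /= map_polyX map_polyC /=.
rewrite !hornerMXaddC hornerD hornerM !hornerC IH.
by rewrite rmorphD rmorphM /= conjCK.
Qed.

Lemma jet_conj k phi Q : jet k phi Q -> exists Q', jet k (fun s => (phi s)^*) Q'.
Proof.
move=> h; have [Q' QE] := ev_conj Q; exists Q'.
by apply: isO_le h => s; rewrite QE -rmorphB nr_conj.
Qed.

Lemma jet_Re k phi Q : jet k phi Q ->
  exists Q', jet k (fun s => rc (complex.Re (phi s))) Q'.
Proof.
move=> h; have [Q' h'] := jet_conj h; exists ((Q + Q') * (2^-1)%:P%:P).
apply: jet_ext (jet_mul (jet_add h h') (jet_cst k _)) => s.
exact/esym/ReJ_add.
Qed.

Lemma jet_Im k phi Q : jet k phi Q ->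
  exists Q', jet k (fun s => rc (complex.Im (phi s))) Q'.
Proof.
move=> h; have := jet_Re (jet_mul h (jet_cst k (-'i))) => -[Q' h']; exists Q'.
apply: jet_ext h' => s; rewrite -complexiE mulrN.
by case: (phi s) => a b /=; rewrite mulr0 mulr1 sub0r opprK.
Qed.

Lemma ev_linear Q : isO 2 (fun s : C =>
  ev Q s - (Q`_0`_0 + Q`_1`_0 * s + Q`_0`_1 * s^*)).
Proof.
have lin (p : {poly C}) : isO 2 (fun s : C => p.[s^*] - (p`_0 + p`_1 * s^*)).
  elim/poly_ind: p => [|p c _].
    by apply: isO_le (isO0 C C 2) => s; rewrite horner0 !coef0 mul0r addr0 subrr.
  elim/poly_ind: p => [|p d _].
    apply: isO_le (isO0 C C 2) => s.
    by rewrite !mul0r !add0r hornerC !coefC mul0r addr0 subrr.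
  have : isO 2 (fun s : C => p.[s^*] * (s^* * s^*)).
    exact: isO_mul (isO_horner p) (isO_mul isO_conj isO_conj).
  apply: isO_ext => s; rewrite !hornerMXaddC !coefD !coefMX !coefC /= coefD coefMX coefC/=.
  ring.
elim/poly_ind: Q => [|Q c _].
  by apply: isO_le (isO0 C C 2) => s; rewrite /ev !horner0 !coef0 !mul0r !addr0 subrr.
elim/poly_ind: Q => [|Q d _].
  apply: isO_le (lin c) => s.
  by rewrite !mul0r !add0r evC !coefC /= ?coef0 mul0r addr0.
have h1 : isO 2 (fun s : C => ev Q s * (s * s)).
  exact: isO_mul (isO_ev Q) (isO_mul (isO_id _) (isO_id _)).
have h2 : isO 2 (fun s : C => (d.[s^*] - d`_0) * s).
  apply: (isO_mul (j := 1)) (isO_id _).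
  elim/poly_ind: d => [|d d0 _].
    by apply: isO_le (isO0 C C 1) => s; rewrite horner0 !coef0 subrr.
  apply: isO_le (isO_mul (isO_horner d) isO_conj) => s.
  by rewrite hornerMXaddC coefD coefMX coefC/= add0r addrK.
apply: isO_ext (isO_add h1 (isO_add h2 (lin c))) => s.
rewrite !evD !evM !evD !evM !evX !evC !coefD !coefMX !coefC /= coefD coefMX coefC /=.
rewrite !add0r addr0.
ring.
Qed.

End jets.

(** * Uniqueness of the conjugate part of a jet *)

Section jet_uniqueness.
Context {R : realType}.
Local Notation C := (CC R).

(** Letting t tend to 0 kills the constant coefficient; dividing by t lowers k. *)
Lemma poly_small_coef0 (k : nat) (p : {poly C}) (B d : R) : 0 < d ->
  (forall t : R, 0 < t < d -> nr p.[rc t] <= B * t ^+ k) ->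
  forall j, (j < k)%N -> p`_j = 0.
Proof.
elim: k p d => // k IH p d d0.
elim/poly_ind: p => [_ j|p c _ pB]; first by rewrite coef0.
have [D D0 pD] : exists2 D : R, 0 <= D & forall t : R, 0 < t < 1 -> nr p.[rc t] <= D.
  elim/poly_ind: p {pB} => [|p b [D D0 pD]].
    by exists 0 => // t _; rewrite horner0 nr0.
  exists (D + nr b); first by rewrite addr_ge0 ?nr_ge0.
  move=> t t1; rewrite hornerMXaddC (le_trans (ler_nrD _ _))// lerD2r nrM nr_rc.
  have /andP[t0 /ltW t1'] := t1.
  by rewrite gtr0_norm// -[D]mulr1 ler_pM ?nr_ge0 ?pD// ltW.
have c0 : c = 0.
  apply/eqP; rewrite -nr_eq0; apply/negP => /negP c0.
  have {}c0 : 0 < nr c by rewrite lt0r c0 nr_ge0.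
  have BD : 0 < `|B| + D + 1 by rewrite ltr_wpDl ?addr_ge0.
  pose t := Num.min (1 / 2) (Num.min (d / 2) (nr c / (2 * (`|B| + D + 1)))).
  have t0 : 0 < t by rewrite !lt_min !divr_gt0// mulr_gt0.
  have t1 : t < 1 by rewrite gt_min; apply/orP; left; lra.
  have td : t < d by rewrite !gt_min; apply/orP; right; apply/orP; left; lra.
  have : t <= nr c / (2 * (`|B| + D + 1)) by rewrite !ge_min lexx !orbT.
  rewrite ler_pdivlMr ?mulr_gt0// => tc.
  have := pB t; rewrite t0 td => /(_ isT).
  rewrite hornerMXaddC => pBt.
  have : nr c <= B * t ^+ k.+1 + D * t.
    rewrite -[c](addKr (p.[rc t] * rc t)) addrC (le_trans (ler_nrD _ _))//.
    rewrite lerD// nrN nrM nr_rc (gtr0_norm t0) ler_pM2r// pD//.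
    by rewrite t0.
  have : B * t ^+ k.+1 <= `|B| * t.
    rewrite exprSr mulrA ler_pM2r//.
    rewrite -[leRHS]mulr1 (le_trans (ler_norm _))// normrM ler_wpM2l//.
    by rewrite normrX gtr0_norm// exprn_ile1// ltW.
  nra.
move=> [|j] jk.
  by rewrite coefD coefMX coefC /= c0 addr0.
rewrite c0 addr0 coefMX /=.
apply: (IH p d d0) => // t td.
have := pB t td; have /andP[t0 _] := td.
rewrite c0 addr0 hornerMX nrM nr_rc (gtr0_norm t0) exprSr mulrA.
by rewrite ler_pM2r.
Qed.

(** On a real line through w the bidegrees (a, b) of equal total degree l merge
    into the coefficient of t^l. *)
Lemma ev_ray (D : {poly {poly C}}) (w : C) : exists p : {poly C},
  (forall t : R, p.[rc t] = ev D (rc t * w)) /\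
  forall l, p`_l = \sum_(b < l.+1) D`_(l - b)`_b * w ^+ (l - b) * w^* ^+ b.
Proof.
elim/poly_ind: D => [|D c [p [pE pl]]].
  exists 0; split=> [t|l]; first by rewrite /ev !horner0.
  by rewrite coef0 big1// => b _; rewrite !coef0 !mul0r.
exists (p * (w *: 'X) + (c \Po (w^* *: 'X))); split=> [t|l].
  rewrite evD evM evX evC hornerD hornerM pE hornerZ hornerX horner_comp.
  rewrite hornerZ hornerX rmorphM /=; congr (_ * _ + c.[_]); first by rewrite mulrC.
  by rewrite mulrC; congr (_ * _); exact/esym/conjc_real.
rewrite coefD -scalerAr coefZ coefMX big_ord_recr /= subnn coefD coefMX /= add0r coefC eqxx.
rewrite expr0 mulr1; congr (_ + _).
  case: l => [|l]; first by rewrite mulr0 big_ord0.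
  rewrite /= pl mulr_sumr; apply: eq_bigr => b _.
  have bl : (b <= l)%N by rewrite -ltnS.
  rewrite coefD coefMX coefC subSn //= addr0 exprS; ring.
elim/poly_ind: c l => [|c d IH] l.
  by rewrite comp_poly0 !coef0 mul0r.
rewrite comp_poly_MXaddC coefD -scalerAr coefZ coefMX coefC coefD coefMX coefC.
case: l => [|l]; first by rewrite mulr0 /= expr0 mulr1.
by rewrite /= !addr0 IH exprS; ring.
Qed.

(** On each line t |-> t w the coefficients below degree k vanish.  The one of
    degree l is w^l q(conj w / w), where the polynomial q lists the coefficients
    of D of bidegree (l - b, b).  As conj w / w runs through infinitely many
    values, q = 0; its leading coefficient is the pure power of conj s. *)
Lemma ev_small_coef0 k (D : {poly {poly C}}) : isO k (ev D) ->
  forall j, (j < k)%N -> D`_0`_j = 0.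
Proof.
move=> [B B0 /near0P[e e0 DB]] l lk.
pose q : {poly C} := \poly_(b < l.+1) D`_(l - b)`_b.
suff q0 : q = 0.
  by have := congr1 (fun p : {poly C} => p`_l) q0; rewrite coef_poly coef0 ltnSn subnn.
(* Points with pairwise distinct conj w / w on the unit circle. *)
pose w (n : nat) : C := 1 + n%:R *: 'i.
have wE n : w n = Complex 1 n%:R.
  rewrite /w -complexiE -(rmorph_nat (@rc R)).
  by apply/eqP; rewrite eq_complex /= !(mulr0,mulr1,mul0r,subr0,addr0,add0r,subrr) !eqxx.
have w0 n : w n != 0 by rewrite wE eq_complex /= oner_eq0.
have root_q n : root q ((w n)^* / w n).
  have [p [pE pl]] := ev_ray D (w n).
  have wn0 : 0 < nr (w n) by rewrite lt0r nr_eq0 w0 nr_ge0.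
  have : p`_l = 0.
    apply: (@poly_small_coef0 k p (B * nr (w n) ^+ k) (e / nr (w n))) => //.
      by rewrite divr_gt0.
    move=> t /andP[t0]; rewrite ltr_pdivlMr// => te.
    have := DB (rc t * w n); rewrite nrM nr_rc gtr0_norm// => /(_ te).
    by rewrite pE exprMn -mulrA [t ^+ k * _]mulrC.
  rewrite pl => pl0; apply/rootP.
  apply: (mulfI (expf_neq0 l (w0 n))); rewrite mulr0 -[RHS]pl0.
  rewrite horner_poly mulr_sumr; apply: eq_bigr => b _.
  have bl : (b <= l)%N by rewrite -ltnS.
  rewrite -{1}(subnK bl) exprD expr_div_n; field.
  exact: expf_neq0.
apply/eqP/negPn/negP => q0.
pose s := [seq (w n)^* / w n | n <- iota 0 (size q)].
have : (size s < size q)%N.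
  apply: max_poly_roots => //.
    by apply/allP => _ /mapP[n _ ->].
  rewrite map_inj_uniq ?iota_uniq// => a b /eqP.
  rewrite eqr_div// !wE => /eqP /(congr1 (@complex.Im R)) /= ab.
  have {}ab : a%:R = b%:R :> R by move: ab; rewrite !mul1r !mulr1; lra.
  by apply/eqP; rewrite -(eqr_nat R) ab.
by rewrite size_map size_iota ltnn.
Qed.

End jet_uniqueness.

(** * Directional derivatives *)

Section directional_derivatives.
Context {R : realType}.
Local Notation C := (CC R).

Lemma is_derive1P (phi : R -> R) (t d : R) : is_derive t 1 phi d <->
  h^-1 * (phi (t + h) - phi t) @[h --> 0^'] --> d.
Proof.
pose q (h : R) := h^-1 * (phi (h * 1 + t) - phi t).
have E : q = (fun h => h^-1 * (phi (t + h) - phi t)).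
  by apply/funext => h; rewrite /q mulr1 [h + t]addrC.
rewrite -E; split=> [[dphi <-]|qd]; first exact: dphi.
by split; [apply/cvg_ex; exists d|exact: (cvg_lim (@norm_hausdorff _ _) qd)].
Qed.

Context (n : nat).
Local Notation V := 'rV[C]_n.
Implicit Types (f g : V -> R) (u v x y : V).

Definition dder f v y (d : R) : Prop :=
  is_derive (0 : R) 1 (fun h => f (y + rc h *: v)) d.

Lemma dder_line f v y (t d : R) : dder f v (y + rc t *: v) d ->
  is_derive t 1 (fun h => f (y + rc h *: v)) d.
Proof.
move=> /is_derive1P; rewrite rmorph0 scale0r addr0 => H; apply/is_derive1P.
have E : (fun h => h^-1 * (f (y + rc t *: v + rc (0 + h) *: v) - f (y + rc t *: v)))
  = (fun h => h^-1 * (f (y + rc (t + h) *: v) - f (y + rc t *: v))).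
  by apply/funext => h; rewrite add0r rmorphD /= scalerDl addrA.
by rewrite -E.
Qed.

Lemma dderZ f v y (c d : R) : dder f v y d -> dder f (rc c *: v) y (c * d).
Proof.
rewrite /dder => fd.
have -> : (fun h => f (y + rc h *: (rc c *: v))) =
          (fun h => f (y + rc h *: v)) \o (fun h => h * c).
  by apply/funext => h /=; rewrite scalerA -rmorphM.
rewrite mulrC; apply: is_derive1_comp.
  by rewrite mul0r.
have H : is_derive (0 : R) (1 : R) (id * cst c : R -> R) (0 *: 0 + c *: 1) by exact: is_deriveM.
by apply: is_derive_eq H _; rewrite scaler0 add0r [_ *: _]mulr1.
Qed.

Lemma MVT01 (phi dphi : R -> R) :
  (forall t : R, 0 <= t <= 1 -> is_derive t 1 phi (dphi t)) ->
  exists2 t : R, 0 <= t <= 1 & phi 1 - phi 0 = dphi t.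
Proof.
move=> H; have [||t t01 tE] := @MVT_segment R phi dphi 0 1 ler01.
- by move=> t; rewrite in_itv /= => /andP[/ltW t0 /ltW t1]; apply: H; rewrite t0 t1.
- apply: derivable_within_continuous => t; rewrite in_itv /= => t01.
  exact: (@ex_derive _ _ _ _ _ _ _ (H t t01)).
by exists t => //; rewrite tE subr0 mulr1.
Qed.

(** Move first along u, then along v.  The second step is governed by the
    derivative field g at an intermediate point given by the mean value theorem,
    which tends to y; this is where continuity of g enters.  The increment h may
    be negative, so the segment is parametrised by [0, 1]. *)
Lemma dderD (U : set V) f g u v y (a : R) : open U -> U y ->
  dder f u y a -> (forall x, U x -> dder f v x (g x)) ->
  {for y, continuous g} -> dder f (u + v) y (a + g y).
Proof.
move=> oU Uy fu fv gc; apply/is_derive1P.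
move/is_derive1P : fu; rewrite !rmorph0 !scale0r !addr0 => fu.
rewrite (_ : (fun h => _) = (fun h => h^-1 * (f (y + rc (0 + h) *: u) - f y)) +
  (fun h => h^-1 * (f (y + rc h *: u + rc h *: v) - f (y + rc h *: u)))); last first.
  apply/funext => h; rewrite /= [RHS]/GRing.add /= add0r -mulrDr scalerDr addrA.
  by congr (_ * _); rewrite [RHS]addrC addrA subrK.
apply: cvgD => //.
apply/cvgrPdist_le => e e0.
have : \forall x \near y, U x /\ `|g y - g x| <= e.
  near=> x; split; near: x; first exact: open_nbhs_nbhs.
  by move/cvgrPdist_le : gc; apply.
move=> /nearP_at [d d0 dP].
near=> h.
have hd : `|h| * (nr u + nr v + 1) < d.
  rewrite -ltr_pdivlMr; last by rewrite ltr_wpDl// addr_ge0 ?nr_ge0.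
  by near: h; apply: dnbhs0_lt; rewrite divr_gt0// ltr_wpDl// addr_ge0 ?nr_ge0.
have h0 : h != 0 by near: h; exact: nbhs_dnbhs_neq.
have small t : 0 <= t <= 1 -> nr (rc h *: u + rc t *: (rc h *: v)) < d.
  move=> /andP[t0 t1]; rewrite (le_lt_trans _ hd)// (le_trans (ler_nrD _ _))//.
  rewrite !nrZ !nr_rc (ger0_norm t0) mulrCA -mulrDr ler_wpM2l//.
  rewrite -addrA lerD2l (@le_trans _ _ (nr v))// ?lerDl//.
  by rewrite -[leRHS]mul1r ler_wpM2r// nr_ge0.
have [|t t01] := @MVT01 (fun t => f (y + rc h *: u + rc t *: (rc h *: v)))
   (fun t => h * g (y + rc h *: u + rc t *: (rc h *: v))).
  move=> t t01; apply: dder_line; apply: dderZ; apply: fv.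
  by have [] := dP _ (small _ t01); rewrite addrA.
rewrite rmorph1 rmorph0 scale1r scale0r addr0 => ->.
rewrite mulrA mulVf// mul1r.
by have [] := dP _ (small _ t01); rewrite addrA.
Unshelve. all: by end_near. Qed.

End directional_derivatives.

(** * Taylor expansion of functions with continuous directional derivatives *)

Section taylor.
Context {R : realType} (n : nat).
Local Notation C := (CC R).
Local Notation V := 'rV[C]_n.
Implicit Types (f g P Q : V -> R) (u v x y : V).

Let Re (z : C) : R := complex.Re z.
Let Im (z : C) : R := complex.Im z.
Local Notation e_ j := (delta_mx 0 j : V).

Lemma ReZ (t : R) (z : C) : Re (rc t * z) = t * Re z.
Proof. by case: z => a b; rewrite /Re /= mul0r subr0. Qed.

Lemma ImZ (t : R) (z : C) : Im (rc t * z) = t * Im z.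
Proof. by case: z => a b; rewrite /Im /= mul0r addr0. Qed.

Lemma ler_Im_nr (z : C) : `|Im z| <= nr z.
Proof.
have := ler_Re_nr (- 'i * z); rewrite nrM nrN nr_i mul1r; congr (`|_| <= _).
by case: z => a b; rewrite /Im -complexiE /= oppr0 mul0r sub0r mulN1r opprK.
Qed.

Lemma real_basis x :
  x = \sum_j (rc (Re (x 0 j)) *: e_ j + rc (Im (x 0 j)) *: ('i *: e_ j)).
Proof.
rewrite {1}[x]row_sum_delta; apply: eq_bigr => j _.
by rewrite scalerA -scalerDl [_ * 'i]mulrC -complexiE -complexE.
Qed.

(** Additivity and homogeneity give the derivative along x from the derivatives
    along the real basis e_j, i e_j. *)
Lemma dder_total (U : set V) f y (fr fi : 'I_n -> V -> R) x : open U -> U y ->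
  (forall j z, U z -> dder f (e_ j) z (fr j z)) ->
  (forall j z, U z -> dder f ('i *: e_ j) z (fi j z)) ->
  (forall j, {for y, continuous (fr j)}) ->
  (forall j, {for y, continuous (fi j)}) ->
  dder f x y (\sum_j (Re (x 0 j) * fr j y + Im (x 0 j) * fi j y)).
Proof.
move=> oU Uy dr di cr ci; rewrite [X in dder _ X _ _](real_basis x).
elim: (index_enum _) => [|j s IH].
  rewrite !big_nil /dder (_ : (fun h => _) = cst (f y)).
    exact: is_derive_cst.
  by apply/funext => h; rewrite scaler0 addr0.
rewrite !big_cons [X in dder _ X _ _]addrC [X in dder _ _ _ X]addrC !addrA.
have step (S : V) (D a : R) (w : V) (g : V -> R) : dder f S y D ->
    (forall z, U z -> dder f w z (g z)) -> {for y, continuous g} ->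
    dder f (S + rc a *: w) y (D + a * g y).
  move=> fS fw gc; apply: (@dderD _ _ U f (fun z => a * g z)) => //.
    by move=> z Uz; apply: dderZ; apply: fw.
  exact: cvgMl_tmp gc.
exact: (step _ _ _ _ _ (step _ _ _ _ _ IH (dr j) (cr j)) (di j) (ci j)).
Qed.

(** Real polynomials in the real and imaginary parts of the coordinates, built by
    multiplying by one coordinate at a time: radial integration is then an
    induction on this construction. *)
Inductive realpoly : (V -> R) -> Prop :=
| realpoly_cst a : realpoly (fun=> a)
| realpoly_add P Q : realpoly P -> realpoly Q -> realpoly (fun x => P x + Q x)
| realpoly_mulRe P j : realpoly P -> realpoly (fun x => P x * Re (x 0 j))
| realpoly_mulIm P j : realpoly P -> realpoly (fun x => P x * Im (x 0 j)).

Lemma realpoly_sum (F : 'I_n -> V -> R) : (forall j, realpoly (F j)) ->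
  realpoly (fun x => \sum_j F j x).
Proof.
move=> FP; elim: (index_enum _) => [|j s IH].
  by under eq_fun do rewrite big_nil; exact: realpoly_cst.
by under eq_fun do rewrite big_cons; exact: realpoly_add.
Qed.

Lemma is_derive_mulr (phi : R -> R) (t d a : R) :
  is_derive t 1 phi d -> is_derive t 1 (fun s => phi s * a) (d * a).
Proof.
move=> /is_derive1P H; apply/is_derive1P.
under eq_fun do rewrite -mulrBl mulrA.
exact: cvgMr_tmp.
Qed.

(** Radial integration.  The weight t^d makes the induction go through: a factor
    Re x_j becomes t Re x_j on the ray, which raises d by one. *)
Lemma realpoly_primitive P : realpoly P -> forall d, exists2 Q, realpoly Q &
  forall x (t : R), is_derive t 1 (fun s => s ^+ d.+1 * Q (rc s *: x))
    (t ^+ d * P (rc t *: x)).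
Proof.
elim=> {P} [a|P1 P2 _ IH1 _ IH2|P j _ IH|P j _ IH] d.
- exists (fun=> a / d.+1%:R); first exact: realpoly_cst.
  move=> x t; have := is_derive_mulr (a / d.+1%:R) (is_derive_poly ('X^(d.+1) : {poly R}) t).
  rewrite derivXn hornerMn hornerXn /= => H.
  rewrite (_ : (fun s => _) = (fun s => ('X^(d.+1) : {poly R}).[s] * (a / d.+1%:R))); last first.
    by apply/funext => s; rewrite hornerXn.
  apply: is_derive_eq H _.
  by rewrite -mulr_natr -mulrA [_%:R * _]mulrC divfK ?pnatr_eq0.
- have [Q1 Q1P Q1d] := IH1 d; have [Q2 Q2P Q2d] := IH2 d.
  exists (fun x => Q1 x + Q2 x); first exact: realpoly_add.
  move=> x t; under eq_fun do rewrite mulrDr; rewrite mulrDr.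
  exact: is_deriveD.
- have [Q QP Qd] := IH d.+1; exists (fun x => Q x * Re (x 0 j)).
    exact: realpoly_mulRe.
  move=> x t; rewrite mxE ReZ (_ : t ^+ d * _ = t ^+ d.+1 * P (rc t *: x) * Re (x 0 j)).
    rewrite (_ : (fun s => _) = (fun s => s ^+ d.+2 * Q (rc s *: x) * Re (x 0 j))).
      exact: is_derive_mulr.
    by apply/funext => s; rewrite mxE ReZ [s ^+ d.+2]exprS; ring.
  by rewrite exprS; ring.
- have [Q QP Qd] := IH d.+1; exists (fun x => Q x * Im (x 0 j)).
    exact: realpoly_mulIm.
  move=> x t; rewrite mxE ImZ (_ : t ^+ d * _ = t ^+ d.+1 * P (rc t *: x) * Im (x 0 j)).
    rewrite (_ : (fun s => _) = (fun s => s ^+ d.+2 * Q (rc s *: x) * Im (x 0 j))).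
      exact: is_derive_mulr.
    by apply/funext => s; rewrite mxE ImZ [s ^+ d.+2]exprS; ring.
  by rewrite exprS; ring.
Qed.

(** Differentiability of class C^k for real-valued functions.  The fields of
    derivatives are quantified existentially, so that no limit has to be named. *)
Fixpoint CkR (k : nat) (U : set V) f : Prop :=
  (forall x, U x -> {for x, continuous f}) /\
  match k with
  | 0 => True
  | k'.+1 => forall v, exists2 g, forall x, U x -> dder f v x (g x) & CkR k' U g
  end.

Lemma CkR_continuous k U f x : CkR k U f -> U x -> {for x, continuous f}.
Proof. by case: k => [|k] [fc _]; exact: fc. Qed.

(** Induction on k.  The partial derivatives have polynomial approximations by
    induction; integrating these along rays gives a polynomial whose radial
    derivative matches that of f up to O(|x|^(k+1)), and the mean value theorem
    on [0, 1] transfers this to the functions. *)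
Lemma taylor k (U : set V) f : open U -> U 0 -> CkR k U f ->
  exists2 P, realpoly P & isO k (fun x => rc (f x - P x) : C).
Proof.
move=> oU U0; elim: k f => [|k IH] f.
  move=> [/(_ 0 U0) f0 _]; exists (fun=> f 0); first exact: realpoly_cst.
  exists 1 => //; near=> x; rewrite expr0 mulr1 nr_rc distrC ltW//.
  by near: x; move/cvgrPdist_lt : f0; apply.
move=> [fc fd].
have pick (w : 'I_n -> V) : exists g P Q : 'I_n -> V -> R, forall j,
    [/\ forall z, U z -> dder f (w j) z (g j z),
        forall z, U z -> {for z, continuous (g j)},
        isO k (fun x => rc (g j x - P j x) : C), realpoly (Q j) &
        forall x (t : R), is_derive t 1 (fun s => s * Q j (rc s *: x)) (P j (rc t *: x))].
  suff /boolp.choice[A AP] : forall j, exists T : (V -> R) * (V -> R) * (V -> R),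
    [/\ forall z, U z -> dder f (w j) z (T.1.1 z),
        forall z, U z -> {for z, continuous T.1.1},
        isO k (fun x => rc (T.1.1 x - T.1.2 x) : C), realpoly T.2 &
        forall x (t : R), is_derive t 1 (fun s => s * T.2 (rc s *: x)) (T.1.2 (rc t *: x))].
    by exists (fun j => (A j).1.1), (fun j => (A j).1.2), (fun j => (A j).2).
  move=> j; have [g gd gk] := fd (w j).
  have [P PP gP] := IH g gk; have [Q QP QE] := realpoly_primitive PP 0.
  exists (g, P, Q); split => //=.
  - by move=> z; exact: CkR_continuous gk.
  - by move=> x t; have := QE x t; rewrite expr0 mul1r; under eq_fun do rewrite expr1.
have [gr [Pr [Qr AP]]] := pick (fun j => e_ j).
have [gi [Pi [Qi BP]]] := pick (fun j => 'i *: e_ j).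
exists (fun x => f 0 + \sum_j (Qr j x * Re (x 0 j) + Qi j x * Im (x 0 j))).
  apply: realpoly_add; first exact: realpoly_cst.
  apply: realpoly_sum => j; apply: realpoly_add.
    by apply: realpoly_mulRe; have [] := AP j.
  by apply: realpoly_mulIm; have [] := BP j.
have : isO k (fun x => \row_j (rc (gr j x - Pr j x) : C)).
  by apply/isO_coord => j; have [_ _ H _ _] := AP j; apply: isO_ext H => x; rewrite mxE.
move=> [Br Br0 BrP].
have : isO k (fun x => \row_j (rc (gi j x - Pi j x) : C)).
  by apply/isO_coord => j; have [_ _ H _ _] := BP j; apply: isO_ext H => x; rewrite mxE.
move=> [Bi Bi0 BiP].
have nU : \forall x \near (0 : V), U x by exact: open_nbhs_nbhs.
have : \forall x \near (0 : V), [/\ U x,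
   nr (\row_j (rc (gr j x - Pr j x) : C)) <= Br * nr x ^+ k &
   nr (\row_j (rc (gi j x - Pi j x) : C)) <= Bi * nr x ^+ k].
  by near=> x; split; near: x.
move=> /near0P[e e0 eP].
exists (\sum_(j < n) (Br + Bi)); first by rewrite sumr_ge0// => j _; rewrite addr_ge0.
apply/near0P; exists e => // x xe.
have tx t : 0 <= t <= 1 -> nr (rc t *: x) <= nr x.
  move=> /andP[t0 t1]; rewrite nrZ nr_rc ger0_norm// -[leRHS]mul1r.
  by rewrite ler_wpM2r// nr_ge0.
(* The error along the ray of x, and its derivative. *)
pose psi (t : R) := f (rc t *: x) - \sum_j (t * Qr j (rc t *: x) * Re (x 0 j) +
   t * Qi j (rc t *: x) * Im (x 0 j)).
pose dpsi (t : R) := \sum_j (Re (x 0 j) * gr j (rc t *: x) + Im (x 0 j) * gi j (rc t *: x))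
   - \sum_j (Pr j (rc t *: x) * Re (x 0 j) + Pi j (rc t *: x) * Im (x 0 j)).
have [|t t01] := @MVT01 _ psi dpsi.
  move=> t t01; have Utx : U (rc t *: x).
    by have [] := eP _ (le_lt_trans (tx _ t01) xe).
  apply: is_deriveB.
    rewrite (_ : (fun s => _) = (fun s => f (0 + rc s *: x))); last first.
      by apply/funext => s; rewrite add0r.
    apply: dder_line; rewrite add0r; apply: (@dder_total U) => //.
    - by move=> j; have [] := AP j.
    - by move=> j; have [] := BP j.
    - by move=> j; have [_ + _ _ _] := AP j; apply.
    - by move=> j; have [_ + _ _ _] := BP j; apply.
  rewrite (_ : (fun s => _) = \sum_(j < n) (fun s => s * Qr j (rc s *: x) * Re (x 0 j) +
     s * Qi j (rc s *: x) * Im (x 0 j))); last first.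
    by apply/funext => s; rewrite fct_sumE.
  apply: is_derive_sum => j; apply: is_deriveD; apply: is_derive_mulr.
    by have [] := AP j.
  by have [] := BP j.
have -> : psi 1 - psi 0 = f x - (f 0 + \sum_j (Qr j x * Re (x 0 j) + Qi j x * Im (x 0 j))).
  rewrite /psi rmorph1 scale1r rmorph0 scale0r.
  under eq_bigr do rewrite !mul1r.
  rewrite [X in f 0 - X]big1 ?subr0; last by move=> j _; rewrite !mul0r addr0.
  by rewrite opprD addrA addrAC.
move=> ->; rewrite nr_rc /dpsi -sumrB (le_trans (ler_norm_sum _ _ _))//.
rewrite mulr_suml ler_sum// => j _.
have [_ er ei] := eP _ (le_lt_trans (tx _ t01) xe).
rewrite (_ : _ - _ = Re (x 0 j) * (gr j (rc t *: x) - Pr j (rc t *: x)) +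
   Im (x 0 j) * (gi j (rc t *: x) - Pi j (rc t *: x))); last by ring.
rewrite (le_trans (ler_normD _ _))// !normrM mulrDl lerD// exprSr mulrA mulrC ler_pM//.
- rewrite -nr_rc; have := nr_coord (\row_j (rc (gr j (rc t *: x) - Pr j (rc t *: x)) : C)) j.
  rewrite mxE => /le_trans; apply; apply: (le_trans er).
  by rewrite ler_wpM2l// lerXn2r ?nnegrE ?nr_ge0// tx.
- by apply: (le_trans (ler_Re_nr _)); exact: nr_coord.
- rewrite -nr_rc; have := nr_coord (\row_j (rc (gi j (rc t *: x) - Pi j (rc t *: x)) : C)) j.
  rewrite mxE => /le_trans; apply; apply: (le_trans ei).
  by rewrite ler_wpM2l// lerXn2r ?nnegrE ?nr_ge0// tx.
- by apply: (le_trans (ler_Im_nr _)); exact: nr_coord.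
Unshelve. all: by end_near. Qed.

End taylor.

(** * Smooth maps along curves *)

Section smooth_jets.
Context {R : realType} (n m : nat).
Local Notation C := (CC R).
Local Notation V := 'rV[C]_n.

(** The coefficients c = 1 and c = -i give the real and the imaginary part of
    the i-th coordinate. *)
Definition refun (c : C) (i : 'I_m) (y : 'rV[C]_m) : R := complex.Re (c * y 0 i).

Lemma refunB c i y z : refun c i (y - z) = refun c i y - refun c i z.
Proof. by rewrite /refun !mxE mulrBr; case: (c * _) => ??; case: (c * _). Qed.

Lemma refunZ c i t y : refun c i (rc t *: y) = t * refun c i y.
Proof.
by rewrite /refun !mxE mulrCA; case: (c * _) => a b /=; rewrite mul0r subr0.
Qed.

Lemma refun_le c i y : `|refun c i y| <= nr c * nr y.
Proof.
rewrite (le_trans (ler_Re_nr _))// nrM ler_wpM2l ?nr_ge0//; exact: nr_coord.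
Qed.

Lemma cvg_refun (T : Type) (F : set_system T) {FF : Filter F} c i
    (f : T -> 'rV[C]_m) L :
  f @ F --> L -> (fun t => refun c i (f t)) @ F --> refun c i L.
Proof.
move=> fL; apply/cvgrPdist_lt => e e0.
have c1 : 0 < nr c + 1 by rewrite ltr_wpDl ?nr_ge0.
have e1 : 0 < rc (e / (nr c + 1)) by rewrite -(rmorph0 (@rc R)) ltr_rc divr_gt0.
near=> t; rewrite -refunB (le_lt_trans (refun_le _ _ _))//.
have : nr (L - f t) < e / (nr c + 1).
  rewrite -ltr_rc rc_nr; near: t.
  by move/cvgrPdist_lt : fL; exact.
rewrite ltr_pdivlMr// mulrC; apply: le_lt_trans.
by rewrite ler_wpM2r ?nr_ge0 ?lerDl.
Unshelve. all: by end_near. Qed.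

Lemma Ck_CkR k (U : set V) (g : V -> 'rV[C]_m) c i :
  Ck k U g -> CkR k U (fun x => refun c i (g x)).
Proof.
elim: k g => [|k IH] g [gc gd].
  by split=> // x Ux; exact: (cvg_refun (gc x Ux)).
split=> [x Ux|v]; first exact: (cvg_refun (gc x Ux)).
have [dv /IH Ckv] := gd v; exists (fun x => refun c i (rderive g x v)) => // x Ux.
apply/is_derive1P.
under eq_fun do rewrite rmorph0 scale0r addr0 add0r -refunB -refunZ.
by have dd := dv x Ux; exact: (cvg_refun dd).
Qed.

(** Jets are closed under sums, products and conjugation. *)
Lemma realpoly_jet k (P : V -> R) (y : C -> V) : realpoly P ->
  (forall j, exists Q, jet k (fun s => y s 0 j) Q) ->
  exists Q, jet k (fun s => rc (P (y s))) Q.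
Proof.
move=> PP yj; elim: PP => {P} [a|P1 P2 _ [Q1 h1] _ [Q2 h2]|P j _ [Q h]|P j _ [Q h]].
- by exists (rc a)%:P%:P; exact: jet_cst.
- exists (Q1 + Q2); apply: jet_ext (jet_add h1 h2) => s.
  by rewrite rmorphD.
- have [Q' h'] := yj j; have [Q'' h''] := jet_Re h'; exists (Q * Q'').
  by apply: jet_ext (jet_mul h h'') => s; rewrite rmorphM.
- have [Q' h'] := yj j; have [Q'' h''] := jet_Im h'; exists (Q * Q'').
  by apply: jet_ext (jet_mul h h'') => s; rewrite rmorphM.
Qed.

Lemma realpoly_lip (P : V -> R) : realpoly P ->
  isO 1 (fun x => rc (P x - P 0) : C).
Proof.
have bounded (P' : V -> R) : isO 1 (fun x => rc (P' x - P' 0) : C) ->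
    isO 0 (fun x => rc (P' x) : C).
  move=> /(isO_weaken (leq0n 1)) h.
  apply: isO_ext (isO_add h (isO_cst _ (rc (P' 0)))) => x.
  by rewrite -rmorphD subrK.
have coord (j : 'I_n) : isO 1 (fun x : V => x 0 j : C).
  by apply: isO_le (isO_id V) => x; exact: nr_coord.
elim=> {P} [a|P1 P2 _ h1 _ h2|P j _ h|P j _ h].
- by apply: isO_ext (isO0 _ _ 1) => x; rewrite subrr rmorph0.
- by apply: isO_ext (isO_add h1 h2) => x; rewrite -rmorphD; congr rc; ring.
- apply: isO_le (isO_mul (bounded _ h) (coord j)) => x.
  rewrite mxE /= mulr0 subr0 rmorphM !nrM ler_wpM2l ?nr_ge0// nr_rc.
  exact: ler_Re_nr.
- apply: isO_le (isO_mul (bounded _ h) (coord j)) => x.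
  rewrite mxE /= mulr0 subr0 rmorphM !nrM ler_wpM2l ?nr_ge0// nr_rc.
  exact: ler_Im_nr.
Qed.

Lemma refun_ReIm (i : 'I_m) (y : 'rV[C]_m) :
  y 0 i = rc (refun 1 i y) + 'i * rc (refun (- 'i) i y).
Proof.
rewrite /refun mul1r mulNr -complexiE {1}[y 0 i]complexE; congr (_ + _ * rc _).
by case: (y 0 i) => a b /=; rewrite mul0r mul1r sub0r opprK.
Qed.

(** Replace g by its Taylor polynomial, then substitute the jets of the curve. *)
Lemma smooth_jet (U : set V) (g : V -> 'rV[C]_m) k (y : C -> V) i :
  open U -> U 0 -> smooth U g -> isO 1 y ->
  (forall j, exists Q, jet k (fun s => y s 0 j) Q) ->
  exists Q, jet k (fun s => g (y s) 0 i) Q.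
Proof.
move=> oU U0 sg y1 yj.
have part c : exists Q, jet k (fun s => rc (refun c i (g (y s)))) Q.
  have [P PP gP] := taylor oU U0 (Ck_CkR c i (sg k)).
  have [Q hQ] := realpoly_jet PP yj; exists Q.
  apply: jet_trans hQ; apply: isO_ext (isO_comp y1 gP) => s.
  by rewrite rmorphB.
have [Q1 h1] := part 1; have [Q2 h2] := part (- 'i).
exists (Q1 + 'i%:P%:P * Q2).
apply: jet_ext (jet_add h1 (jet_mul (jet_cst k 'i) h2)) => s.
by rewrite [RHS]refun_ReIm.
Qed.

Lemma smooth_lip (U : set V) (g : V -> 'rV[C]_m) :
  open U -> U 0 -> smooth U g -> isO 1 (fun x => g x - g 0).
Proof.
move=> oU U0 sg; apply/isO_coord => i.
have part c : isO 1 (fun x => rc (refun c i (g x) - refun c i (g 0)) : C).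
  have [P PP gP] := taylor oU U0 (Ck_CkR c i (sg 1%N)).
  have g0 := isO_near0 gP.
  apply: isO_ext (isO_add gP (realpoly_lip PP)) => x.
  rewrite -rmorphD; congr rc; have : refun c i (g 0) - P 0 = 0.
    by apply: (fmorph_inj (@rc R)); rewrite rmorph0.
  by move/eqP; rewrite subr_eq0 => /eqP ->; ring.
apply: isO_ext (isO_add (part 1) (isO_mul (isO_cst _ 'i) (part (- 'i)))) => x.
by rewrite !mxE [g x 0 i]refun_ReIm [g 0 0 i]refun_ReIm !rmorphB /=; ring.
Qed.

End smooth_jets.

(** * Truncation of convergent power series *)

Section power_series.
Context {R : realType}.
Local Notation C := (CC R).

Lemma psum_box n (c : mpseries n) (x : 'rV[C]_n) k N : (k.+1 <= N)%N ->
  psum c x k.+1 = \sum_(a : {ffun 'I_n -> 'I_N} | [forall j, (a j < k.+1)%N])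
    c [ffun j => nat_of_ord (a j)] * \prod_j x 0 j ^+ a j.
Proof.
move=> kN; pose h (b : {ffun 'I_n -> 'I_k.+1}) : {ffun 'I_n -> 'I_N} :=
  [ffun j => widen_ord kN (b j)].
pose h' (a : {ffun 'I_n -> 'I_N}) : {ffun 'I_n -> 'I_k.+1} := [ffun j => inord (a j)].
rewrite (reindex_onto h h') => [|a /forallP ak]; last first.
  by apply/ffunP => j; rewrite !ffunE; apply: val_inj; rewrite /= inordK.
apply: eq_big => [b|b _].
  apply/esym/andP; split.
    by apply/forallP => j; rewrite ffunE /=.
  by apply/eqP/ffunP => j; rewrite !ffunE; apply: val_inj; rewrite /= inordK.
congr (c _ * _); first by apply/ffunP => j; rewrite !ffunE.
by apply: eq_bigr => j _; rewrite ffunE.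
Qed.

(** A multi-index outside the box of side k+1 has total degree at least k+1, so
    its monomial at x is at most (|x|/r)^(k+1) times the one at radius r; the
    latter are summable with the coefficients. *)
Lemma psum_tail n (c : mpseries n) (r : R) k : 0 < r -> abs_convergent c r ->
  exists2 B : R, 0 <= B & forall (x : 'rV[C]_n) l, nr x < r ->
    psum c x @ \oo --> l -> nr (l - psum c x k.+1) <= B * nr x ^+ k.+1.
Proof.
move=> r0 [B0 cB].
have absB N : \sum_(a : {ffun 'I_n -> 'I_N})
    nr (c [ffun j => nat_of_ord (a j)]) * r ^+ (\sum_j a j) <= B0.
  rewrite -ler_rc; apply: le_trans (cB N); rewrite le_eqVlt; apply/orP; left.
  rewrite rmorph_sum; apply/eqP; apply: eq_bigr => a _.
  rewrite rmorphM /= rc_nr; congr (_ * _).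
  by rewrite rmorphXn /= expr_sum; apply: eq_bigr => j _; rewrite mxE.
have B00 : 0 <= B0.
  apply: le_trans (absB 0%N); apply: sumr_ge0 => a _.
  by rewrite mulr_ge0 ?nr_ge0 ?exprn_ge0// ltW.
exists (B0 / r ^+ k.+1); first by rewrite divr_ge0// exprn_ge0// ltW.
move=> x l xr xl.
have x0 := nr_ge0 x.
have xr1 : nr x / r <= 1 by rewrite ler_pdivrMr// mul1r ltW.
have part N : (k.+1 <= N)%N ->
    nr (psum c x N - psum c x k.+1) <= B0 / r ^+ k.+1 * nr x ^+ k.+1.
  move=> kN; rewrite {1}/psum (bigID (fun a : {ffun 'I_n -> 'I_N} => [forall j, (a j < k.+1)%N])) /=.
  rewrite (psum_box _ _ kN) addrAC subrr add0r (le_trans (nr_sum _ _ _))//.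
  rewrite -mulrA [_^-1 * _]mulrC -expr_div_n.
  apply: (@le_trans _ _ (\sum_(a : {ffun 'I_n -> 'I_N} | ~~ [forall j, (a j < k.+1)%N])
     (nr (c [ffun j => nat_of_ord (a j)]) * r ^+ (\sum_j a j)) * (nr x / r) ^+ k.+1)).
    apply: ler_sum => a; rewrite negb_forall => /existsP[j]; rewrite -leqNgt => kj.
    have ka : (k.+1 <= \sum_j a j)%N.
      by apply: (leq_trans kj); rewrite (bigD1 j)//= leq_addr.
    rewrite nrM -mulrA ler_wpM2l ?nr_ge0//.
    apply: (@le_trans _ _ (nr x ^+ (\sum_j a j))).
      rewrite expr_sum (big_morph (@nr R C) (@nrM R) (@nr1 R)).
      apply: ler_prod => i _; rewrite nr_ge0 nrX lerXn2r ?nnegrE ?nr_ge0//.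
      exact: nr_coord.
    have -> : nr x = r * (nr x / r) by rewrite mulrC divfK// gt_eqF.
    rewrite exprMn [r * (_ / _)]mulrC divfK ?gt_eqF//.
    rewrite ler_wpM2l ?exprn_ge0//; first exact: ltW.
    by rewrite ler_wiXn2l// divr_ge0// ltW.
  rewrite -mulr_suml ler_wpM2r ?exprn_ge0 ?divr_ge0 ?(ltW r0)//.
  apply: le_trans (absB N).
  rewrite [leRHS](bigID (fun a : {ffun 'I_n -> 'I_N} => [forall j, (a j < k.+1)%N])) /=.
  by rewrite lerDr sumr_ge0// => a _; rewrite mulr_ge0 ?nr_ge0 ?exprn_ge0// ltW.
apply/ler_addgt0Pr => e e0.
have e0' : 0 < rc e by rewrite -(rmorph0 (@rc R)) ltr_rc.
have : \forall N \near \oo, nr (l - psum c x N) < e /\ (k.+1 <= N)%N.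
  near=> N; split; last by near: N; exact: nbhs_infty_ge.
  rewrite -ltr_rc rc_nr; near: N.
  by move/cvgrPdist_lt : xl; exact.
move=> [N _ /(_ N (leqnn N)) [lN /part pN]].
rewrite -[l - _](subrKA (psum c x N)) (le_trans (ler_nrD _ _))// addrC.
by rewrite lerD// ltW.
Unshelve. all: by end_near. Qed.

(** Complex-differentiability at 0 with a quadratic remainder, in a form that is
    visibly stable under sums and products. *)
Definition has_linear_part n (f : 'rV[C]_n -> C) : Prop :=
  exists (b : C) (L : 'cV[C]_n), isO 2 (fun x => f x - b - (x *m L) 0 0).

Lemma isO_mulmxr (W : normedModType C) k n p (f : W -> 'rV[C]_n) (L : 'M[C]_(n, p)) :
  isO k f -> isO k (fun x => f x *m L).
Proof.
move=> /isO_coord fk; apply/isO_coord => i.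
have : isO k (fun x => \sum_j f x 0 j * L j i).
  by apply: isO_sum => j _; rewrite -[k]addn0; exact: isO_mul (fk j) (isO_cst _ _).
by apply: isO_ext => x; rewrite mxE.
Qed.

Lemma isO_mulmx n p (L : 'M[C]_(n, p)) : isO 1 (fun x : 'rV[C]_n => x *m L).
Proof. exact: isO_mulmxr (isO_id _). Qed.

Lemma isO_linear n (L : 'cV[C]_n) : isO 1 (fun x : 'rV[C]_n => (x *m L) 0 0 : C).
Proof. by apply: isO_le (isO_mulmx L) => x; exact: nr_coord. Qed.

Lemma mx11D (A B : 'M[C]_1) : (A + B) 0 0 = A 0 0 + B 0 0.
Proof. by rewrite mxE. Qed.

Lemma mx11Z a (A : 'M[C]_1) : (a *: A) 0 0 = a * A 0 0.
Proof. by rewrite mxE. Qed.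

Lemma linear_part_ext n (f g : 'rV[C]_n -> C) : f =1 g ->
  has_linear_part f -> has_linear_part g.
Proof.
by move=> fg [b [L h]]; exists b, L; apply: isO_ext h => x; rewrite fg.
Qed.

Lemma linear_part_cst n (a : C) : has_linear_part (fun _ : 'rV[C]_n => a).
Proof.
by exists a, 0; apply: isO_ext (isO0 _ _ 2) => x; rewrite mulmx0 mxE subrr subr0.
Qed.

Lemma linear_part_coord n (j : 'I_n) : has_linear_part (fun x : 'rV[C]_n => x 0 j).
Proof.
exists 0, (delta_mx j 0); apply: isO_ext (isO0 _ _ 2) => x.
by rewrite -colE mxE subr0 subrr.
Qed.

Lemma linear_part_add n (f g : 'rV[C]_n -> C) : has_linear_part f ->
  has_linear_part g -> has_linear_part (fun x => f x + g x).
Proof.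
move=> [b [L fL]] [d [M gM]]; exists (b + d), (L + M).
by apply: isO_ext (isO_add fL gM) => x; rewrite mulmxDr mx11D; ring.
Qed.

Lemma linear_part_bounded n (f : 'rV[C]_n -> C) b (L : 'cV[C]_n) :
  isO 2 (fun x => f x - b - (x *m L) 0 0) -> isO 0 f.
Proof.
move=> /(isO_weaken (leq0n 2)) h.
have := isO_add h (isO_add (isO_cst _ b) (isO_weaken (leq0n 1) (isO_linear L))).
by apply: isO_ext => x; ring.
Qed.

Lemma linear_part_mul n (f g : 'rV[C]_n -> C) : has_linear_part f ->
  has_linear_part g -> has_linear_part (fun x => f x * g x).
Proof.
move=> [b [L fL]] [d [M gM]]; exists (b * d), (b *: M + d *: L).
have h1 := isO_mul (linear_part_bounded fL) gM.
have affine : isO 0 (fun x : 'rV[C]_n => d + (x *m M) 0 0 : C).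
  exact: isO_add (isO_cst _ _) (isO_weaken (leq0n 1) (isO_linear M)).
have h2 := isO_mul fL affine.
have h3 := isO_mul (isO_linear L) (isO_linear M).
apply: isO_ext (isO_add h1 (isO_add h2 h3)) => x.
by rewrite mulmxDr -!scalemxAr mx11D !mx11Z; ring.
Qed.

Lemma linear_part_sum n I (s : seq I) (f : I -> 'rV[C]_n -> C) :
  (forall i, has_linear_part (f i)) -> has_linear_part (fun x => \sum_(i <- s) f i x).
Proof.
move=> h; elim: s => [|i s IH].
  by apply: linear_part_ext (@linear_part_cst n 0) => x; rewrite big_nil.
by apply: linear_part_ext (linear_part_add (h i) IH) => x; rewrite big_cons.
Qed.

Lemma linear_part_prod n I (s : seq I) (f : I -> 'rV[C]_n -> C) :
  (forall i, has_linear_part (f i)) -> has_linear_part (fun x => \prod_(i <- s) f i x).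
Proof.
move=> h; elim: s => [|i s IH].
  by apply: linear_part_ext (@linear_part_cst n 1) => x; rewrite big_nil.
by apply: linear_part_ext (linear_part_mul (h i) IH) => x; rewrite big_cons.
Qed.

Lemma linear_part_exp n (f : 'rV[C]_n -> C) k :
  has_linear_part f -> has_linear_part (fun x => f x ^+ k).
Proof.
move=> h; elim: k => [|k IH]; first exact: linear_part_cst.
by apply: linear_part_ext (linear_part_mul h IH) => x; rewrite exprS.
Qed.

Lemma linear_partP n (f : 'rV[C]_n -> C) : has_linear_part f ->
  exists L : 'cV[C]_n, isO 2 (fun x => f x - f 0 - (x *m L) 0 0).
Proof.
move=> [b [L h]]; exists L; have := isO_near0 h.
by rewrite mul0mx mxE subr0 => /eqP; rewrite subr_eq0 => /eqP ->.
Qed.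

Lemma psum_linear_part n (c : mpseries n) N :
  has_linear_part (fun x : 'rV[C]_n => psum c x N).
Proof.
apply: linear_part_sum => a; apply: linear_part_mul; first exact: linear_part_cst.
by apply: linear_part_prod => j; apply: linear_part_exp; exact: linear_part_coord.
Qed.

Lemma psum_jet n (c : mpseries n) N k (y : C -> 'rV[C]_n) (Q : 'I_n -> {poly {poly C}}) :
  (forall j, jet k (fun s => y s 0 j) (Q j)) ->
  jet k (fun s => psum c (y s) N) (\sum_(a : {ffun 'I_n -> 'I_N})
    (c [ffun j => nat_of_ord (a j)])%:P%:P * \prod_j Q j ^+ a j).
Proof.
move=> yQ; apply: jet_sum => a _; apply: jet_mul; first exact: jet_cst.
by apply: jet_prod => j _; exact: jet_exp.
Qed.

Lemma pseries_approx n (c : mpseries n) (f : 'rV[C]_n -> C) a k :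
  has_pseries c f a -> isO k.+1 (fun x => f (a + x) - psum c x k.+1).
Proof.
move=> [r [r0 cr fr]]; have [B B0 BP] := psum_tail k r0 cr.
exists B => //; apply/near0P; exists r => // x xr; apply: BP => //.
by apply: fr; rewrite -rc_nr ltr_rc.
Qed.

Lemma nr_row_mx_conj n (z : 'rV[C]_n) : nr (row_mx z (conj_row z)) <= nr z.
Proof.
apply: nr_rV_le; first exact: nr_ge0.
move=> j; rewrite mxE; case: (fintype.split j) => i; first exact: nr_coord.
by rewrite mxE nr_conj nr_coord.
Qed.

Lemma zzbar_approx n (c : mpseries (n + n)) (f : 'rV[C]_n -> C) a k :
  has_zzbar_series c f a ->
  isO k.+1 (fun x => f (a + x) - psum c (row_mx x (conj_row x)) k.+1).
Proof.
move=> [r [r0 cr fr]]; have [B B0 BP] := psum_tail k r0 cr.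
exists B => //; apply/near0P; exists r => // x xr.
have xr' := le_lt_trans (nr_row_mx_conj x) xr.
apply: (le_trans (BP _ _ xr' _)).
  by apply: fr; rewrite -rc_nr ltr_rc.
by rewrite ler_wpM2l// lerXn2r ?nnegrE ?nr_ge0// nr_row_mx_conj.
Qed.

Lemma holomorphic_linear n (f : 'rV[C]_n -> C) a : holomorphic_at f a ->
  exists L : 'cV[C]_n, isO 2 (fun x => f (a + x) - f a - (x *m L) 0 0).
Proof.
move=> [c /(pseries_approx 1) fc].
have [b [L cL]] := psum_linear_part c 2.
have [|L' h] := @linear_partP _ (fun x => f (a + x)).
  exists b, L; apply: isO_ext (isO_add fc cL) => x; ring.
by exists L'; apply: isO_ext h => x; rewrite addr0.
Qed.

Lemma real_analytic_linear n (f : 'rV[C]_n -> C) a : real_analytic_at f a ->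
  exists L : 'cV[C]_(n + n),
    isO 2 (fun x => f (a + x) - f a - (row_mx x (conj_row x) *m L) 0 0).
Proof.
move=> [c /(zzbar_approx 1) fc].
have [b [L cL]] := psum_linear_part c 2.
have row1 : isO 1 (fun x : 'rV[C]_n => row_mx x (conj_row x)).
  by apply: isO_le (isO_id _) => x; exact: nr_row_mx_conj.
have h : isO 2 (fun x => f (a + x) - b - (row_mx x (conj_row x) *m L) 0 0).
  by apply: isO_ext (isO_add fc (isO_comp row1 cL)) => x; ring.
exists L; have := isO_near0 h; rewrite addr0.
have -> : row_mx (0 : 'rV[C]_n) (conj_row (0 : 'rV[C]_n)) = 0.
  by apply/eqP; rewrite -nr_eq0 eq_le nr_ge0 (le_trans (nr_row_mx_conj _))// nr0.
by rewrite mul0mx mxE subr0 => /eqP; rewrite subr_eq0 => /eqP ->.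
Qed.

End power_series.

(** * Finite germs along curves *)

Section finite_germs.
Context {R : realType}.
Local Notation C := (CC R).

Lemma exists_left_kernel (K : fieldType) m n (A : 'M[K]_(m, n)) : (n < m)%N ->
  exists2 v : 'rV[K]_m, v != 0 & v *m A = 0.
Proof.
move=> nm; exists (nz_row (kermx A)); last by apply/sub_kermxP; exact: nz_row_sub.
rewrite nz_row_eq0 -mxrank_eq0 mxrank_ker subn_eq0 -ltnNge.
exact: leq_ltn_trans (rank_leq_col A) nm.
Qed.

(** The series of x |-> x_i^e. *)
Definition monomial_series n (i : 'I_n) e : mpseries (R := R) n :=
  fun b => (b == [ffun j => if j == i then e else 0%N])%:R.

Lemma psum_monomial n (i : 'I_n) e (x : 'rV[C]_n) N :
  psum (monomial_series i e) x N = if (e < N)%N then x 0 i ^+ e else 0.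
Proof.
rewrite /psum /monomial_series; case: ifPn => [eN|]; last first.
  rewrite -leqNgt => Ne; apply: big1 => a _.
  case: eqP => [/ffunP/(_ i)|]; last by rewrite mul0r.
  by rewrite !ffunE eqxx => aie; have := ltn_ord (a i); rewrite aie ltnNge Ne.
have N0 : (0 < N)%N by exact: leq_ltn_trans eN.
pose a0 : {ffun 'I_n -> 'I_N} := [ffun j => if j == i then Ordinal eN else Ordinal N0].
rewrite (bigD1 a0)//= [X in _ + X]big1 ?addr0 => [|a aa0].
  have -> : [ffun j => nat_of_ord (a0 j)] == [ffun j => if j == i then e else 0%N].
    by apply/eqP/ffunP => j; rewrite !ffunE; case: eqP.
  rewrite mul1r.
  rewrite (bigD1 i)//= big1 ?mulr1 => [|j /negbTE ji]; first by rewrite ffunE eqxx.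
  by rewrite ffunE ji expr0.
case: eqP => [aE|]; last by rewrite mul0r.
case/eqP: aa0; apply/ffunP => j; apply: val_inj; rewrite ffunE /=.
by move/ffunP : aE => /(_ j); rewrite !ffunE; case: eqP.
Qed.

Lemma holomorphic_monomial n (i : 'I_n) e (a : 'rV[C]_n) :
  holomorphic_at (fun x => (x 0 i - a 0 i) ^+ e : C) a.
Proof.
exists (monomial_series i e), 1; split => //.
  exists 1 => N; rewrite (_ : (fun _ => _) = monomial_series i e).
    rewrite psum_monomial mxE rmorph1; case: ifP => _; first by rewrite expr1n.
    exact: ler01.
  by apply/funext => b; rewrite /monomial_series normr_nat.
move=> x _; rewrite mxE addrAC subrr add0r.
apply: cvg_near_cst; near=> N; rewrite psum_monomial ifT//.
by near: N; exact: nbhs_infty_gt.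
Unshelve. all: by end_near. Qed.

(** The k+1 powers 1, t, ..., t^k of t = x_i - p_i are dependent modulo the
    ideal when k germs span the quotient.  The cofactors are kept as explicit
    combinations of holomorphic germs, from which their jets are computed. *)
Lemma finite_germ_coord n m (F : 'rV[C]_n -> 'rV[C]_m) (p : 'rV[C]_n) (i : 'I_n) :
  finite_germ F p -> exists (q : {poly C}) K (v : 'I_K -> C)
    (u : 'I_K -> 'I_m -> 'rV[C]_n -> C),
  [/\ q != 0, forall e j, holomorphic_at (u e j) p &
    \forall x \near p, q.[(x : 'rV[C]_n) 0 i - p 0 i] =
      \sum_j (\sum_e v e * u e j x) * (F x 0 j - F p 0 j)].
Proof.
move=> [k [g [gh spans]]].
have mono (e : 'I_k.+1) := spans _ (holomorphic_monomial i e p).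
have /boolp.choice[l {}mono] := mono.
have /boolp.choice[u {}mono] := mono.
have [v v0 vA] := @exists_left_kernel _ k.+1 k (\matrix_(e, j) l e j) (leqnn _).
exists (\poly_(e < k.+1) v 0 (inord e)), k.+1, (v 0), u; split.
- apply: contra v0 => /eqP q0; apply/eqP/rowP => e; rewrite mxE.
  have := congr1 (fun q : {poly C} => q`_e) q0.
  by rewrite coef_poly ltn_ord inord_val coef0.
- by move=> e j; have [] := mono e.
have : \forall x \near p, forall e : 'I_k.+1,
    ((x : 'rV[C]_n) 0 i - p 0 i) ^+ e - \sum_j l e j * g j x = \sum_j u e j x * (F x 0 j - F p 0 j).
  exact: (filter_forall _ (fun e => (mono e).2)).
apply: filterS => x xE.
rewrite horner_poly.
under eq_bigr do rewrite inord_val.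
transitivity (\sum_e v 0 e * \sum_j u e j x * (F x 0 j - F p 0 j)); last first.
  under eq_bigr do rewrite mulr_sumr.
  rewrite exchange_big /=; apply: eq_bigr => j _.
  by rewrite mulr_suml; apply: eq_bigr => e _; rewrite mulrA.
under [RHS]eq_bigr do rewrite -xE mulrBr.
rewrite big_split /= -[LHS]addr0; congr (_ + _).
rewrite sumrN; apply/esym/eqP; rewrite oppr_eq0; apply/eqP.
under eq_bigr do rewrite mulr_sumr.
rewrite exchange_big /= big1// => j _.
have : (v *m \matrix_(e, j) l e j) 0 j = 0 by rewrite vA mxE.
rewrite mxE => vA0.
transitivity ((\sum_e v 0 e * l e j) * g j x).
  by rewrite mulr_suml; apply: eq_bigr => e _; rewrite mulrA.
rewrite (eq_bigr (fun e => v 0 e * (\matrix_(e, j) l e j) e j)).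
  by rewrite vA0 mul0r.
by move=> e _; rewrite mxE.
Qed.

Lemma jet_exists_sum k (I : finType) (phi : I -> C -> C) :
  (forall i, exists Q, jet k (phi i) Q) -> exists Q, jet k (fun s => \sum_i phi i s) Q.
Proof.
by move=> /boolp.choice[Q h]; exists (\sum_i Q i); apply: jet_sum.
Qed.

Lemma holomorphic_jet n (f : 'rV[C]_n -> C) (p : 'rV[C]_n) k (y : C -> 'rV[C]_n) :
  holomorphic_at f p -> isO 1 (fun s => y s - p) ->
  (forall i, exists Q, jet k (fun s => y s 0 i) Q) ->
  exists Q, jet k (fun s => f (y s)) Q.
Proof.
move=> [c fc] y1 /boolp.choice[Q yQ].
have yQ' i : jet k (fun s => (y s - p) 0 i) (Q i + (- p 0 i)%:P%:P).
  by apply: jet_ext (jet_add (yQ i) (jet_cst k (- p 0 i))) => s; rewrite !mxE.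
eexists; apply: jet_trans (psum_jet c k.+1 yQ').
apply: isO_weaken (leqnSn k) _.
apply: isO_ext (isO_comp y1 (pseries_approx k fc)) => s.
by rewrite [p + _]addrC subrK.
Qed.

(** The heart of the argument.  Let T be the jet of t = h_i - p_i along the
    curve, and apply to q(t) = sum_j w_j (F_j - F_j(p)) the ring morphism
    Q |-> Q`_0, which sets s to 0 and keeps conj s.  The right-hand side is
    killed, so q composed with T`_0 vanishes to high order.  If q = X^e q1 with
    q1(0) <> 0, its coefficient of degree e is q1(0) times the e-th power of the
    linear coefficient of T`_0, which is therefore 0.  So h has no linear term
    in conj s. *)
Lemma finite_germ_no_conj_part n m (F : 'rV[C]_n -> 'rV[C]_m) (p : 'rV[C]_n)
    (h : C -> 'rV[C]_n) :
  finite_germ F p -> isO 1 (fun s => h s - p) ->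
  (forall k i, exists Q, jet k (fun s => h s 0 i) Q) ->
  (forall k j, exists2 Q, jet k (fun s => F (h s) 0 j - F p 0 j) Q & Q`_0 = 0) ->
  exists A : 'rV[C]_n, isO 2 (fun s => h s - p - s *: A).
Proof.
move=> finF h1 hQ FQ.
suff /boolp.choice[A AP] : forall i : 'I_n, exists a : C,
    isO 2 (fun s => h s 0 i - p 0 i - s * a).
  exists (\row_i A i); apply/isO_coord => i; apply: isO_ext (AP i) => s.
  by rewrite !mxE.
move=> i.
have [q [K [v [u [q0 uh qE]]]]] := finite_germ_coord i finF.
have [e [q1 q10 qE1]] := multiplicity_XsubC q 0.
rewrite q0 /= in q10.
(* Order e.+2 reaches the coefficient of degree e and the linear terms. *)
pose k := e.+2.
have [Q hi] := hQ k i.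
pose T := Q + (- p 0 i)%:P%:P.
have tT : jet k (fun s => h s 0 i - p 0 i) T := jet_add hi (jet_cst k _).
have T0 : T`_0`_0 = 0.
  have h0 : h 0 - p = 0 := isO_near0 h1.
  have := isO_near0 tT; rewrite (_ : h 0 0 i - p 0 i = 0); last first.
    by have /matrixP/(_ 0 i) := h0; rewrite !mxE.
  by rewrite /ev polyC0 conjC0 !horner_coef0 sub0r => /eqP; rewrite oppr_eq0 => /eqP.
have hp : \forall s \near (0 : C), q.[h s 0 i - p 0 i] =
      \sum_j (\sum_e v e * u e j (h s)) * (F (h s) 0 j - F p 0 j).
  have qE' : \forall x \near (0 : 'rV[C]_n), q.[(p + x) 0 i - p 0 i] =
      \sum_j (\sum_e v e * u e j (p + x)) * (F (p + x) 0 j - F p 0 j).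
    by move/nearP_at : qE => [d d0 dP]; apply/near0P; exists d.
  have := isO_near_comp h1 qE'.
  by apply: filterS => s; rewrite [p + _]addrC subrK.
have /boolp.choice[W wW] : forall j, exists Q,
    jet k (fun s => \sum_e v e * u e j (h s)) Q.
  move=> j; apply: jet_exists_sum => a.
  have [Qu hu] := holomorphic_jet (uh a j) h1 (hQ k).
  by exists ((v a)%:P%:P * Qu); exact: jet_mul (jet_cst k _) hu.
have /boolp.choice[G GP] : forall j, exists Q,
    jet k (fun s => F (h s) 0 j - F p 0 j) Q /\ Q`_0 = 0.
  by move=> j; have [Q' ? ?] := FQ k j; exists Q'.
(* Two jets of one function: their difference D is small. *)
pose D := (map_poly (polyC \o polyC) q).[T] - \sum_j W j * G j.
have Dsmall : isO k (ev D).
  have h1' := jet_horner q tT.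
  have h2' : jet k (fun s => \sum_j (\sum_e v e * u e j (h s)) * (F (h s) 0 j - F p 0 j))
      (\sum_j W j * G j).
    apply: jet_sum => j _; apply: jet_mul (wW j) _; by have [] := GP j.
  have h3' := jet_near hp h1'.
  by apply: isO_ext (isO_sub h2' h3') => s; rewrite evB; ring.
have De := ev_small_coef0 Dsmall (ltnW (ltnSn e.+1)).
have D0 : D`_0 = q \Po T`_0.
  rewrite coefB -!horner_coef0 horner_sum big1 ?subr0; last first.
    by move=> j _; have [_ Gj] := GP j; rewrite hornerM !horner_coef0 Gj mulr0.
  rewrite /comp_poly; elim/poly_ind: (q) => [|r c IH].
    by rewrite !map_poly0 !horner0.
  by rewrite !rmorphD !rmorphM /= !map_polyX !map_polyC /= !hornerMXaddC hornerD hornerM IH hornerC.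
have T1 : T`_0`_1 = 0.
  have [r TE] : exists r, T`_0 = r * 'X.
    have /factor_theorem[r rE] : root T`_0 0 by rewrite /root horner_coef0 T0.
    by exists r; rewrite rE polyC0 subr0.
  move: De; rewrite D0 qE1 polyC0 subr0 comp_polyM comp_Xn_poly TE exprMn mulrA.
  rewrite coefMXn ltnn subnn -horner_coef0 hornerM horner_comp hornerM hornerX mulr0.
  move/eqP; rewrite mulf_eq0 -[_ == 0]/(root q1 0) (negbTE q10) /= horner_exp.
  by rewrite expf_eq0 => /andP[_ /eqP r0]; rewrite coefMX /= -horner_coef0.
exists T`_1`_0.
apply: isO_ext (isO_add (isO_weaken (isT : (2 <= k)%N) tT) (ev_linear T)) => s.
by rewrite T0 T1; ring.
Qed.

End finite_germs.

(** * Tangent directions of real-analytic submanifolds *)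

Section hypersurface.
Context {R : realType} (n : nat).
Local Notation C := (CC R).
Local Notation V := 'rV[C]_n.

Lemma isO_nr_le (W X : normedModType C) k (f : W -> X) : isO k f ->
  exists B e : R, [/\ 0 <= B, 0 < e & forall x, nr x < e -> nr (f x) <= B * nr x ^+ k].
Proof. by move=> [B B0 /near0P[e e0 fB]]; exists B, e. Qed.

Lemma continuous_on_line (f : V -> R) (b w : V) (t : R) :
  isO 1 (fun x => rc (f (b + rc t *: w + x) - f (b + rc t *: w)) : C) ->
  {for t, continuous (fun s => f (b + rc s *: w))}.
Proof.
move=> /isO_nr_le[B [e [B0 e0 fB]]]; apply/cvgrPdist_lt => d d0.
have c0 : 0 < nr w + 1 by rewrite ltr_wpDl ?nr_ge0.
have c1 : 0 < B * nr w + 1 by rewrite ltr_wpDl ?mulr_ge0 ?nr_ge0.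
near=> s.
have ew : nr (rc (s - t) *: w) < e.
  rewrite nrZ nr_rc (@le_lt_trans _ _ (`|s - t| * (nr w + 1))) ?ler_wpM2l ?lerDl//.
  rewrite -ltr_pdivlMr// distrC; near: s.
  by apply: (@cvgr_dist_lt _ R^o); [exact: cvg_id|rewrite divr_gt0].
have fw : `|f (b + rc s *: w) - f (b + rc t *: w)| <= B * (`|s - t| * nr w).
  have := fB _ ew; have -> : b + rc t *: w + rc (s - t) *: w = b + rc s *: w.
    by rewrite -addrA -scalerDl -rmorphD /= [t + _]addrC subrK.
  by rewrite nr_rc expr1 nrZ nr_rc.
rewrite distrC (le_lt_trans fw)//.
rewrite mulrCA (@le_lt_trans _ _ (`|s - t| * (B * nr w + 1))) ?ler_wpM2l ?lerDl//.
rewrite -ltr_pdivlMr// distrC; near: s.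
by apply: (@cvgr_dist_lt _ R^o); [exact: cvg_id|rewrite divr_gt0].
Unshelve. all: by end_near. Qed.

(** The real part of the linear terms of the series in (z, conj z). *)
Lemma real_analytic_differential (r : V -> R) p :
  real_analytic_at (fun y => rc (r y)) p -> exists Lam : V -> R,
  [/\ forall x y, Lam (x + y) = Lam x + Lam y,
      forall t x, Lam (rc t *: x) = t * Lam x,
      isO 2 (fun x => rc (r (p + x) - r p - Lam x) : C) &
      forall v, rdifferential r p v = Lam v].
Proof.
move=> /real_analytic_linear[L rL].
pose Lam (x : V) : R := complex.Re ((row_mx x (conj_row x) *m L) 0 0).
have LamD x y : Lam (x + y) = Lam x + Lam y.
  rewrite /Lam (_ : row_mx (x + y) _ = row_mx x (conj_row x) + row_mx y (conj_row y)).
    by rewrite mulmxDl mx11D; case: (_ 0 0) => ??; case: (_ 0 0).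
  by rewrite add_row_mx /conj_row map_mxD.
have LamZ t x : Lam (rc t *: x) = t * Lam x.
  rewrite /Lam (_ : row_mx (rc t *: x) _ = rc t *: row_mx x (conj_row x)).
    by rewrite -scalemxAl mx11Z; case: (_ 0 0) => a b /=; rewrite mul0r subr0.
  rewrite scale_row_mx; congr row_mx; apply/rowP => j; rewrite !mxE rmorphM /=.
  by congr (_ * _); exact: conjc_real.
have rLam : isO 2 (fun x => rc (r (p + x) - r p - Lam x) : C).
  apply: isO_le rL => x; rewrite nr_rc; apply: le_trans (ler_Re_nr _).
  rewrite le_eqVlt; apply/orP; left; apply/eqP; congr `|_|.
  by rewrite /Lam -!rmorphB; case: (_ 0 0).
exists Lam; split => // v; rewrite /rdifferential derive1E.
apply: (@derive_val _ _ _ _ _ (fun t : R => r (p + rc t *: v)) (Lam v)).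
apply/is_derive1P; apply/cvgrPdist_lt => d d0.
have [B [e [B0 e0 rB]]] := isO_nr_le rLam.
have c0 : 0 < nr v + 1 by rewrite ltr_wpDl ?nr_ge0.
have c1 : 0 < B * nr v ^+ 2 + 1 by rewrite ltr_wpDl ?mulr_ge0 ?exprn_ge0 ?nr_ge0.
near=> h.
have h0 : h != 0 by near: h; exact: nbhs_dnbhs_neq.
have ev : nr (rc h *: v) < e.
  rewrite nrZ nr_rc (@le_lt_trans _ _ (`|h| * (nr v + 1))) ?ler_wpM2l ?lerDl//.
  by rewrite -ltr_pdivlMr//; near: h; apply: dnbhs0_lt; rewrite divr_gt0.
rewrite rmorph0 scale0r addr0 add0r distrC.
have -> : h^-1 * (r (p + rc h *: v) - r p) - Lam v =
    h^-1 * (r (p + rc h *: v) - r p - Lam (rc h *: v)).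
  by rewrite LamZ [RHS]mulrBr mulKf.
rewrite normrM normfV mulrC ltr_pdivrMr ?normr_gt0//.
have := rB _ ev; rewrite nr_rc => /le_lt_trans; apply.
rewrite nrZ nr_rc exprMn mulrCA expr2 -mulrA mulrC ltr_pM2r ?normr_gt0//.
rewrite (@le_lt_trans _ _ (`|h| * (B * nr v ^+ 2 + 1))) ?ler_wpM2l ?lerDl//.
by rewrite -ltr_pdivlMr//; near: h; apply: dnbhs0_lt; rewrite divr_gt0.
Unshelve. all: by end_near. Qed.

Lemma real_analytic_lip (r : V -> R) p : real_analytic_at (fun y => rc (r y)) p ->
  isO 1 (fun x => rc (r (p + x) - r p) : C).
Proof.
move=> /real_analytic_linear[L rL].
have row1 : isO 1 (fun x : V => row_mx x (conj_row x)).
  by apply: isO_le (isO_id _) => x; exact: nr_row_mx_conj.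
apply: isO_ext (isO_add (isO_weaken (isT : (1 <= 2)%N) rL) (isO_comp row1 (isO_linear L))) => x.
by rewrite rmorphB; ring.
Qed.

(** There are points p + x of N arbitrarily close to p with x as close to the
    ray of v, relatively to its size, as desired.  Unlike the existence of a
    curve in N with velocity v, this follows from the intermediate value theorem
    alone. *)
Definition approx_tangent (N : set V) (p v : V) : Prop :=
  forall eps del : R, 0 < eps -> 0 < del -> exists (t : R) (x : V),
    [/\ 0 < t < del, N (p + x) & nr (x - rc t *: v) <= eps * t].

Lemma approx_tangent_open (N U : set V) p v : open U -> U p -> U `<=` N ->
  approx_tangent N p v.
Proof.
move=> oU Up UN eps del eps0 del0.
have /nearP_at[e e0 eU] : \forall x \near p, U x by exact: open_nbhs_nbhs.
have c0 : 0 < nr v + 1 by rewrite ltr_wpDl ?nr_ge0.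
pose t := Num.min (del / 2) (e / (2 * (nr v + 1))).
have t0 : 0 < t by rewrite lt_min !divr_gt0// mulr_gt0.
have td : t <= del / 2 by rewrite ge_min lexx.
have te : t <= e / (2 * (nr v + 1)) by rewrite ge_min lexx orbT.
exists t, (rc t *: v); split.
- by rewrite t0 /=; lra.
- apply/UN/eU; rewrite nrZ nr_rc gtr0_norm//.
  rewrite ler_pdivlMr ?mulr_gt0// in te.
  by have := nr_ge0 v; nra.
- by rewrite subrr nr0 mulr_ge0 ?ltW.
Qed.

(** Near p + t v the function r is Lam(tau w) = tau up to O(t^2), so it changes
    sign as tau crosses [- eta t, eta t], and vanishes there by the intermediate
    value theorem. *)
Lemma approx_tangent_zero (U : set V) (r : V -> R) (Lam : V -> R) p v w :
  open U -> U p -> (forall x, U x -> real_analytic_at (fun y => rc (r y)) x) ->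
  r p = 0 ->
  (forall x y, Lam (x + y) = Lam x + Lam y) ->
  (forall t x, Lam (rc t *: x) = t * Lam x) ->
  isO 2 (fun x => rc (r (p + x) - r p - Lam x) : C) ->
  Lam v = 0 -> Lam w = 1 ->
  approx_tangent [set x | U x /\ r x = 0] p v.
Proof.
move=> oU Up ra rp LamD LamZ rLam Lv Lw eps del eps0 del0.
have [B [e1 [B0 e10 rB]]] := isO_nr_le rLam.
have /nearP_at[e2 e20 eU] : \forall x \near p, U x by exact: open_nbhs_nbhs.
have v0 := nr_ge0 v; have w0 := nr_ge0 w.
pose eta := eps / (nr w + 1).
have eta0 : 0 < eta by rewrite divr_gt0// ltr_wpDl.
(* K t bounds the size of t v + tau w for |tau| <= eta t, and the last
   bound on t makes the quadratic error at most eta t. *)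
pose K := nr v + eta * nr w + 1.
have K0 : 0 < K by rewrite ltr_wpDl// addr_ge0// mulr_ge0// ltW.
pose t := Num.min (del / 2) (Num.min (e1 / (2 * K)) (Num.min (e2 / (2 * K)) (eta / (B * K ^+ 2 + 1)))).
have BK : 0 < B * K ^+ 2 + 1 by rewrite ltr_wpDl ?mulr_ge0 ?exprn_ge0// ltW.
have K2 : 0 < 2 * K by rewrite mulr_gt0.
have t0 : 0 < t.
  rewrite !lt_min (divr_gt0 del0 (ltr0n _ 2)) (divr_gt0 e10 K2).
  by rewrite (divr_gt0 e20 K2) (divr_gt0 eta0 BK).
have td : t <= del / 2 by rewrite ge_min lexx.
have te1 : t <= e1 / (2 * K) by rewrite !ge_min lexx /= !orbT.
have te2 : t <= e2 / (2 * K) by rewrite !ge_min lexx /= !orbT.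
have teta : t <= eta / (B * K ^+ 2 + 1) by rewrite !ge_min lexx /= !orbT.
rewrite ler_pdivlMr ?mulr_gt0// in te1.
rewrite ler_pdivlMr ?mulr_gt0// in te2.
rewrite ler_pdivlMr// in teta.
have small tau : `|tau| <= eta * t -> nr (rc t *: v + rc tau *: w) <= t * K.
  move=> taut; rewrite (le_trans (ler_nrD _ _))// !nrZ !nr_rc (gtr0_norm t0).
  rewrite /K -addrA mulrDr lerD2l mulrDr (@le_trans _ _ (eta * t * nr w)) ?ler_wpM2r//.
  by rewrite mulrAC mulrC mulrA lerDl mulr1 ltW.
have smallU tau : `|tau| <= eta * t -> U (p + (rc t *: v + rc tau *: w)).
  move=> /small h; apply: eU; apply: (le_lt_trans h); nra.
have est tau : `|tau| <= eta * t ->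
    `|r (p + (rc t *: v + rc tau *: w)) - tau| <= eta * t.
  move=> /small h; have := rB _ (le_lt_trans h _).
  rewrite rp subr0 LamD !LamZ Lv Lw mulr0 add0r mulr1 nr_rc => /(_ _)/le_trans; apply; first nra.
  rewrite (@le_trans _ _ (B * (t * K) ^+ 2))//.
    by rewrite ler_wpM2l// lerXn2r ?nnegrE ?nr_ge0// mulr_ge0// ltW.
  rewrite (_ : B * (t * K) ^+ 2 = t * (B * K ^+ 2) * t); last by ring.
  by rewrite ler_pM2r//; move: teta; rewrite mulrDr mulr1; lra.
pose phi tau := r (p + rc t *: v + rc tau *: w).
have estphi tau : `|tau| <= eta * t -> `|phi tau - tau| <= eta * t.
  by move=> /est; rewrite addrA.
have etat : 0 < eta * t by rewrite mulr_gt0.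
have [|||tau] := @IVT R phi (- (eta * t)) (eta * t) 0.
- by lra.
- apply: continuous_in_subspaceT => tau /set_mem /=; rewrite in_itv /= => taut.
  apply: continuous_on_line; apply: real_analytic_lip; apply: ra.
  by rewrite -addrA; apply: smallU; rewrite ler_norml.
- have minmax0 (a b : R) : a <= 0 -> 0 <= b -> Num.min a b <= 0 <= Num.max a b.
    by move=> a0 b0; rewrite ge_min le_max a0 b0 orbT.
  have h1 : 0 <= phi (eta * t).
    have := estphi (eta * t); rewrite (gtr0_norm etat) => /(_ (lexx _)).
    by rewrite ler_norml => /andP[+ _]; rewrite lerBrDr addNr.
  have h2 : phi (- (eta * t)) <= 0.
    have := estphi (- (eta * t)); rewrite normrN (gtr0_norm etat) => /(_ (lexx _)).
    by rewrite ler_norml => /andP[_]; rewrite opprK -lerBrDr subrr.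
  exact: minmax0.
rewrite in_itv /= => taut phi0.
have taut' : `|tau| <= eta * t by rewrite ler_norml.
exists t, (rc t *: v + rc tau *: w); split.
- by rewrite t0 /=; lra.
- by split; [exact: smallU|rewrite addrA].
- rewrite addrAC subrr add0r nrZ nr_rc (le_trans (ler_wpM2r w0 taut'))//.
  have etaE : eta * (nr w + 1) = eps by rewrite divfK// gt_eqF// ltr_wpDl.
  by rewrite mulrAC ler_wpM2r ?(ltW t0)// -etaE mulrDr mulr1 lerDl ltW.
Qed.

Lemma approx_tangent_sub (N N' : set V) p v : N `<=` N' ->
  approx_tangent N p v -> approx_tangent N' p v.
Proof.
move=> NN h eps del e0 d0; have [t [x [? Nx ?]]] := h eps del e0 d0.
by exists t, x; split => //; apply: NN.
Qed.

(** Real codimension at most 1 leaves a nonzero real direction in every complex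
    line: a real-linear form on a real plane has a kernel. *)
Lemma complex_line_tangent d (N : set V) p w0 : analytic_submanifold d N -> N p ->
  (d <= 1)%N -> w0 != 0 -> exists2 c : C, c != 0 & approx_tangent N p (c *: w0).
Proof.
move=> sN Np d1 w00; have [U [r [oU Up ra NU indep]]] := sN p Np.
case: d d1 r ra NU indep {sN} => [|[|//]] _ r ra NU indep.
  exists 1; first exact: oner_neq0.
  by apply: (approx_tangent_open _ oU Up) => x Ux; apply/NU => // -[].
have [Lam [LamD LamZ rLam rd]] := real_analytic_differential (ra ord0 p Up).
have [w Lw] : exists w, Lam w != 0.
  apply: contrapT => /forallNP Lam0.
  have := indep p Up (fun=> 1) _ ord0 => /(_ _)/eqP; rewrite oner_eq0 => H.
  suff : false by []. apply: H => v; rewrite big_ord1 mul1r rd.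
  by apply/eqP/negPn/negP; exact: Lam0.
have [c c0 Lc] : exists2 c : C, c != 0 & Lam (c *: w0) = 0.
  have [L0|L0] := eqVneq (Lam w0) 0.
    by exists 1; [exact: oner_neq0|rewrite scale1r].
  (* With a = Lam(i w0) and b = Lam(w0), Lam vanishes at (a - b i) w0. *)
  exists (rc (Lam ('i *: w0)) - rc (Lam w0) * 'i).
    apply: contra L0; rewrite -complexiE eq_complex /= => /andP[_].
    by rewrite mul0r addr0 mulr1 sub0r oppr_eq0.
  rewrite scalerBl -scalerA -scaleN1r -(rmorphN1 (@rc R)) LamD !LamZ.
  by rewrite mulN1r mulrC subrr.
exists c => //.
have rp : r ord0 p = 0 by apply: (proj1 (NU p Up)).
have Lw1 : Lam (rc (Lam w)^-1 *: w) = 1 by rewrite LamZ mulVf.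
apply: approx_tangent_sub (approx_tangent_zero oU Up (ra ord0) rp LamD LamZ rLam Lc Lw1).
by move=> x [Ux rx]; apply/NU => // k; rewrite ord1.
Qed.

(** Every real line of the parameter plane gives a curve in N. *)
Lemma tangent_line (N : set V) p (h : C -> V) A : isO 2 (fun s => h s - p - s *: A) ->
  (\forall s \near (0 : C), N (h s)) -> forall c : C, tangent N p (c *: A).
Proof.
move=> hA hN c; exists (fun t => h (rc t * c)).
have h0 : h 0 = p.
  by have := isO_near0 hA; rewrite scale0r subr0 => /eqP; rewrite subr_eq0 => /eqP.
have small e : 0 < e -> \forall t \near (0 : R), nr (rc t * c) < e.
  move=> e0; have c0 : 0 < nr c + 1 by rewrite ltr_wpDl ?nr_ge0.
  have : \forall t \near (0 : R^o), `|t| < e / (nr c + 1) by exact/nbhs0_lt/divr_gt0.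
  apply: filterS => t te; rewrite nrM nr_rc.
  by rewrite (@le_lt_trans _ _ (`|t| * (nr c + 1))) ?ler_wpM2l ?lerDl// -ltr_pdivlMr.
split; first by rewrite rmorph0 mul0r.
  move/near0P : hN => [e e0 eN]; have := small e e0.
  by apply: filterS => t /eN.
have [B [e [B0 e0 hB]]] := isO_nr_le hA.
apply/cvgrPdist_lt => d d0.
have dE : d = rc (complex.Re d).
  by apply/eqP; rewrite eq_complex /= eqxx /= ger0_Im // ltW.
have c1 : 0 < B * nr c ^+ 2 + 1 by rewrite ltr_wpDl ?mulr_ge0 ?exprn_ge0 ?nr_ge0.
have d0' : 0 < complex.Re d by rewrite -ltr_rc rmorph0 -dE.
near=> t.
have t0 : t != 0 by near: t; exact: nbhs_dnbhs_neq.
have te : nr (rc t * c) < e by near: t; apply: nbhs_dnbhs; exact: small.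
rewrite -rc_nr dE ltr_rc nr_distC.
have -> : rc t^-1 *: (h (rc t * c) - p) - c *: A =
    rc t^-1 *: (h (rc t * c) - p - (rc t * c) *: A).
  by rewrite [RHS]scalerBr scalerA mulrA -rmorphM (mulVf t0) rmorph1 mul1r.
rewrite nrZ nr_rc normfV mulrC ltr_pdivrMr ?normr_gt0//.
apply: (le_lt_trans (hB _ te)).
rewrite nrM nr_rc exprMn mulrCA expr2 -mulrA mulrC ltr_pM2r ?normr_gt0//.
rewrite (@le_lt_trans _ _ (`|t| * (B * nr c ^+ 2 + 1))) ?ler_wpM2l ?lerDl//.
by rewrite -ltr_pdivlMr//; near: t; apply: dnbhs0_lt; rewrite divr_gt0.
Unshelve. all: by end_near. Qed.

End hypersurface.

(** * Graphs and antiholomorphic vectors *)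

Section graph.
Context {R : realType} (m : nat).
Local Notation C := (CC R).
Implicit Types (rho : 'rV[C]_m -> C).

(** The part free of s comes from the monomials free of z, whose coefficients
    vanish because rho(0, conj z) = 0. *)
Lemma zzbar_line_jet (c : mpseries (m + m)) rho (e : 'rV[C]_m) k :
  has_zzbar_series c rho 0 -> (forall b, set_z0 c b = 0) ->
  exists2 Q, jet k (fun s => rho (s *: e)) Q & Q`_0 = 0.
Proof.
move=> crho c0.
pose Q (j : 'I_(m + m)) : {poly {poly C}} := match fintype.split j with
  | inl i => (e 0 i)%:P%:P * 'X
  | inr i => ((e 0 i)^*)%:P%:P * 'X%:P end.
have yQ j : jet k (fun s => (row_mx (s *: e) (conj_row (s *: e))) 0 j) (Q j).
  rewrite /Q; case: split_ordP => i ->.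
    apply: jet_ext (jet_mul (jet_cst k (e 0 i)) (jet_id k)) => s.
    by rewrite row_mxEl mxE mulrC.
  apply: jet_ext (jet_mul (jet_cst k ((e 0 i)^*)) (jet_conj_id k)) => s.
  by rewrite row_mxEr !mxE rmorphM mulrC.
exists (\sum_(a : {ffun 'I_(m + m) -> 'I_k.+1})
    (c [ffun j => nat_of_ord (a j)])%:P%:P * \prod_j Q j ^+ a j).
  have line1 : isO 1 (fun s : C => s *: e).
    exact: isO_scale (isO_id _) (isO_cst _ e).
  apply: jet_trans (psum_jet c k.+1 yQ).
  apply: isO_weaken (leqnSn k) _.
  apply: isO_ext (isO_comp line1 (zzbar_approx k crho)) => s.
  by rewrite add0r.
rewrite coef_sum big1// => a _; rewrite coefCM.
case: (boolP [exists i : 'I_m, a (lshift m i) != ord0]) => [/existsP[i ai]|].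
  rewrite (bigD1 (lshift m i))//= -horner_coef0 hornerM horner_exp /Q.
  rewrite (unsplitK (inl i)) hornerM hornerX mulr0 expr0n.
  by rewrite (negbTE (ai : nat_of_ord (a (lshift m i)) != 0%N)) mul0r mulr0.
rewrite negb_exists => /forallP a0.
rewrite (_ : c _ = 0) ?mul0r//.
rewrite -(c0 [ffun k => nat_of_ord (a (rshift m k))]) /set_z0; congr c.
apply/ffunP => j; rewrite !ffunE; case: split_ordP => i ->; last by rewrite ffunE.
by have := a0 i; rewrite negbK => /eqP ->.
Qed.

Lemma zzbar_small (c : mpseries (m + m)) rho :
  has_zzbar_series c rho 0 -> rho 0 = 0 -> isO 1 rho.
Proof.
move=> crho rho0; have [L rL] := @real_analytic_linear _ _ rho 0 (ex_intro _ c crho).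
have row1 : isO 1 (fun x : 'rV[C]_m => row_mx x (conj_row x)).
  by apply: isO_le (isO_id _) => x; exact: nr_row_mx_conj.
apply: isO_ext (isO_add (isO_weaken (isT : (1 <= 2)%N) rL) (isO_comp row1 (isO_linear L))) => x.
by rewrite add0r rho0; ring.
Qed.

Definition graph_point rho (z : 'rV[C]_m) : 'rV[C]_(m + 1) :=
  row_mx z (const_mx (rho z)).

Lemma graph_pointP rho (x : 'rV[C]_(m + 1)) :
  rsubmx x 0 0 = rho (lsubmx x) <-> x = graph_point rho (lsubmx x).
Proof.
split=> [xE|->]; last by rewrite /graph_point row_mxKr row_mxKl mxE.
rewrite -{1}[x]hsubmxK /graph_point -xE; congr row_mx.
by apply/rowP => j; rewrite [RHS]mxE ord1.
Qed.

Lemma nr_graph_point rho z : nr (graph_point rho z) <= nr z + nr (rho z).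
Proof.
apply: nr_rV_le; first by rewrite addr_ge0 ?nr_ge0.
move=> j; rewrite mxE; case: (fintype.split j) => i.
  by rewrite (le_trans (nr_coord _ _))// lerDl nr_ge0.
by rewrite mxE lerDr nr_ge0.
Qed.

Lemma isO_graph_point rho : isO 1 rho -> isO 1 (graph_point rho).
Proof.
move=> [B B0 rB]; exists (1 + B); first by rewrite addr_ge0.
apply: filterS rB => z; rewrite !expr1 => zB.
by rewrite (le_trans (nr_graph_point _ _))// mulrDl mul1r lerD2l.
Qed.

End graph.

Section cr_dimension.
Context {R : realType} (n : nat).
Local Notation C := (CC R).

(** Y = A and X = - i A satisfy X + i Y = 0, and both lie on the line of A. *)
Lemma T01_complex_line (N : set 'rV[C]_n) p A :
  (forall c : C, tangent N p (c *: A)) -> T01 N p ((2 * 'i) *: conj_row A).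
Proof.
move=> tA; exists (- 'i *: A), A; split; first exact: tA.
- by rewrite -[A]scale1r; exact: tA.
- by rewrite scaleNr addNr.
- apply/rowP => j; rewrite !mxE rmorphM rmorphN /= conjCi opprK.
  by rewrite -mulrDl mulr2n -mulr2n mulr_natl mulr2n mulrDl.
Qed.

(** The right inverse B of A is what guarantees independence of the rows; it is
    transported by conjugation. *)
Lemma dimT01_ge k (N : set 'rV[C]_n) p (A : 'M[C]_(k, n)) (B : 'M[C]_(n, k)) :
  (k <= n)%N -> A *m B = 1%:M ->
  (forall i (c : C), tangent N p (c *: row i A)) -> (k <= dimT01 N p)%N.
Proof.
move=> kn AB tA; rewrite /dimT01 /cdim.
apply: (@leq_bigmax_cond _ _ (fun k : 'I_n.+1 => nat_of_ord k) (Ordinal (kn : (k < n.+1)%N))).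
apply/asboolP => /=; exists ((2 * 'i) *: map_mx Num.conj A); split.
  apply/row_freeP; exists ((2 * 'i)^-1 *: map_mx Num.conj B).
  rewrite -scalemxAl -scalemxAr scalerA divff ?scale1r ?mulf_neq0 ?pnatr_eq0 ?neq0Ci//.
  by rewrite -map_mxM AB map_mx1.
move=> i; rewrite linearZ /= -map_row.
exact: T01_complex_line.
Qed.

End cr_dimension.

(** * Lifting complex lines through the map *)

Section lifting.
Context {R : realType} (m : nat).
Local Notation C := (CC R).
Context (M N U : set 'rV[C]_(m + 1)) (rho : 'rV[C]_m -> C).
Context (c : mpseries (R := R) (m + m)).
Context (F g : 'rV[C]_(m + 1) -> 'rV[C]_(m + 1)) (p : 'rV[C]_(m + 1)).
Context (crho : has_zzbar_series c rho 0) (rho1 : isO 1 rho).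
Context (Mrho : \forall x \near (0 : 'rV[C]_(m + 1)),
  M x <-> rsubmx x 0 0 = rho (lsubmx x)).
Context (Fp : F p = 0) (Fhol : forall j, holomorphic_at (fun y => F y 0 j) p).
Context (oU : open U) (U0 : U 0) (sg : smooth U g) (g0 : g 0 = p).
Context (MNF : forall x, M x -> U x -> N (g x) /\ F (g x) = x).
Context (NMF : forall x, N x -> M (F x)).
Context (gF : forall x, N x -> U (F x) -> g (F x) = x).

(** The graph of rho near 0 lies in M, where g inverts F. *)
Let graph_inverse : \forall z \near (0 : 'rV[C]_m),
  N (g (graph_point rho z)) /\ F (g (graph_point rho z)) = graph_point rho z.
Proof.
have gp1 := isO_graph_point rho1.
have nU : \forall x \near (0 : 'rV[C]_(m + 1)), U x by exact: open_nbhs_nbhs.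
have MU : \forall x \near (0 : 'rV[C]_(m + 1)),
    x = graph_point rho (lsubmx x) -> M x /\ U x.
  near=> x; move=> xg; split; last by near: x.
  suff H : M x <-> rsubmx x 0 0 = rho (lsubmx x) by apply/H/graph_pointP.
  by near: x.
have := isO_near_comp gp1 MU; apply: filterS => z.
by rewrite /graph_point row_mxKl => /(_ erefl) [Mz Uz]; exact: MNF.
Unshelve. all: by end_near. Qed.

Lemma isO_line (V : normedModType C) (e : V) : isO 1 (fun s : C => s *: e).
Proof. exact: isO_scale (isO_id _) (isO_cst _ e). Qed.

(** The coordinates of F along the lift are those of the graph point: multiples
    of s, and rho(s e).  None of them has a part free of s. *)
Lemma line_lift (e : 'rV[C]_m) : (forall b, set_z0 c b = 0) -> finite_germ F p ->
  exists2 A, isO 2 (fun s : C => g (graph_point rho (s *: e)) - p - s *: A) &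
    \forall s \near (0 : C), N (g (graph_point rho (s *: e))) /\
      F (g (graph_point rho (s *: e))) = graph_point rho (s *: e).
Proof.
move=> c0 finF.
have gp1 : isO 1 (fun s : C => graph_point rho (s *: e)).
  exact: isO_comp (isO_line e) (isO_graph_point rho1).
have nearh := isO_near_comp (isO_line e) graph_inverse.
have coordQ k j : exists2 Q, jet k (fun s => graph_point rho (s *: e) 0 j) Q & Q`_0 = 0.
  case: (split_ordP j) => i ->.
    exists ((e 0 i)%:P%:P * 'X); last by rewrite coefMX.
    apply: jet_ext (jet_mul (jet_cst k (e 0 i)) (jet_id k)) => s.
    by rewrite row_mxEl mxE mulrC.
  have [Q rQ Q0] := zzbar_line_jet e k crho c0; exists Q => //.
  by apply: jet_ext rQ => s; rewrite row_mxEr mxE.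
have [||||A AP] := @finite_germ_no_conj_part _ _ _ F p (fun s => g (graph_point rho (s *: e))).
- exact: finF.
- by rewrite -g0; exact: isO_comp gp1 (smooth_lip oU U0 sg).
- move=> k i; apply: (smooth_jet i oU U0 sg gp1) => j.
  by have [Q ? _] := coordQ k j; exists Q.
- move=> k j; have [Q jQ Q0] := coordQ k j; exists Q => //.
  apply: jet_near jQ; apply: filterS nearh => s [_ ->].
  by rewrite Fp [X in _ - X]mxE subr0.
by exists A.
Qed.

Lemma differential_Fz : exists D : 'M[C]_(m + 1, m),
  isO 2 (fun x => lsubmx (F (p + x)) - x *m D).
Proof.
have /boolp.choice[L LP] : forall j, exists L : 'cV[C]_(m + 1),
    isO 2 (fun x => F (p + x) 0 j - F p 0 j - (x *m L) 0 0).
  by move=> j; exact: holomorphic_linear (Fhol j).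
exists (\matrix_(i, j) L (lshift 1 j) i 0); apply/isO_coord => j.
apply: isO_ext (LP (lshift 1 j)) => x.
rewrite Fp !mxE subr0; congr (_ - _); apply: eq_bigr => i _; by rewrite !mxE.
Qed.

Lemma F_lip : isO 1 (fun x => F (p + x)).
Proof.
apply/isO_coord => j; have [L LP] := holomorphic_linear (Fhol j).
apply: isO_ext (isO_add (isO_weaken (isT : (1 <= 2)%N) LP) (isO_linear L)) => x.
by rewrite Fp mxE; ring.
Qed.

(** A point p + x of N is recovered from its image by the Lipschitz map g, and
    the image, a point of the graph, is controlled by its z-coordinates. *)
Lemma N_lower_bound : exists2 B : R, 0 <= B & \forall x \near (0 : 'rV[C]_(m + 1)),
  N (p + x) -> nr x <= B * nr (lsubmx (F (p + x))).
Proof.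
have [B1 B10 gB] := smooth_lip oU U0 sg.
have [B2 B20 rB] := isO_graph_point rho1.
exists (B1 * B2); first by rewrite mulr_ge0.
have nU : \forall x \near (0 : 'rV[C]_(m + 1)), U x by exact: open_nbhs_nbhs.
have proj1 : isO 1 (fun x : 'rV[C]_(m + 1) => lsubmx x).
  apply: isO_le (isO_id _) => x; apply: nr_rV_le; first exact: nr_ge0.
  by move=> j; rewrite mxE; exact: nr_coord.
have rB' := isO_near_comp proj1 rB.
have target : \forall y \near (0 : 'rV[C]_(m + 1)), M y -> U y /\
    nr (g y - p) <= B1 * B2 * nr (lsubmx y).
  near=> y => My; split; first by near: y.
  have yE : y = graph_point rho (lsubmx y).
    apply/graph_pointP; suff H : M y <-> rsubmx y 0 0 = rho (lsubmx y) by apply/H.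
    by near: y.
  have gy : nr (g y - g 0) <= B1 * nr y ^+ 1 by near: y.
  have ry : nr (graph_point rho (lsubmx y)) <= B2 * nr (lsubmx y) ^+ 1 by near: y.
  rewrite -g0 (le_trans gy)// -mulrA ler_wpM2l// expr1 {1}yE.
  by rewrite expr1 in ry.
have := isO_near_comp F_lip target; apply: filterS => x xP Nx.
have [Ux] := xP (NMF Nx).
by rewrite gF// addrAC subrr add0r.
Unshelve. all: by end_near. Qed.

(** At a point p + x with x close to t v the z-coordinates of F are O(eps t),
    since D kills v, while x has size t |v|: this contradicts the lower bound. *)
Lemma no_approx_tangent (D : 'M[C]_(m + 1, m)) (v : 'rV[C]_(m + 1)) :
  isO 2 (fun x => lsubmx (F (p + x)) - x *m D) -> v != 0 -> v *m D = 0 ->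
  ~ approx_tangent N p v.
Proof.
move=> /isO_nr_le[B1 [e1 [B10 e10 FD]]] v0 vD tv.
have [B0 B00 /near0P[e2 e20 Nlow]] := N_lower_bound.
have [B2 [e3 [B20 e30 D1]]] := isO_nr_le (isO_mulmx D).
have nv : 0 < nr v by rewrite lt0r nr_eq0 v0 nr_ge0.
(* Both error terms below are at most |v| / 4: the part linear in eps by the
   choice of eps, the quadratic part by that of del. *)
pose eps := Num.min 1 (nr v / (4 * (1 + B0 * B2))).
have BB : 0 < 1 + B0 * B2 by rewrite ltr_pwDl// mulr_ge0.
have eps0 : 0 < eps by rewrite lt_min ltr01 /= divr_gt0// mulr_gt0.
have eps1 : eps <= 1 by rewrite ge_min lexx.
have epsv : eps * (4 * (1 + B0 * B2)) <= nr v.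
  by rewrite -ler_pdivlMr ?mulr_gt0// ge_min lexx orbT.
pose K := nr v + 1.
have K0 : 0 < K by rewrite ltr_wpDl// nr_ge0.
pose BK := B0 * B1 * K ^+ 2.
have BK0 : 0 <= BK by apply: mulr_ge0; [exact: mulr_ge0|exact: sqr_ge0].
pose del := Num.min (e1 / K) (Num.min (e2 / K) (Num.min e3 (nr v / (4 * (BK + 1))))).
have BK1 : 0 < 4 * (BK + 1) by rewrite mulr_gt0// ltr_wpDl.
have del0 : 0 < del.
  by rewrite !lt_min (divr_gt0 e10 K0) (divr_gt0 e20 K0) e30 (divr_gt0 nv BK1).
have [t [x [/andP[t0 td] Nx xt]]] := tv eps del eps0 del0.
have := td; rewrite !lt_min (ltr_pdivlMr _ _ K0) (ltr_pdivlMr _ _ K0) (ltr_pdivlMr _ _ BK1).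
move=> /and4P[te1 te2 te3 tv4].
have xK : nr x <= t * K.
  rewrite -[x](subrK (rc t *: v)) (le_trans (ler_nrD _ _))// nrZ nr_rc gtr0_norm//.
  apply: (le_trans (lerD xt (lexx _))); rewrite /K; nra.
have xlow : t * nr v <= nr x + eps * t.
  rewrite -[t](gtr0_norm t0) -nr_rc -nrZ -[rc t *: v](subrK x) (le_trans (ler_nrD _ _))//.
  by rewrite addrC lerD2l nr_distC nr_rc gtr0_norm.
have xD : nr (x *m D) <= B2 * (eps * t).
  rewrite -[x](subrK (rc t *: v)) mulmxDl -scalemxAl vD scaler0 addr0.
  have xe3 : nr (x - rc t *: v) < e3 by apply: (le_lt_trans xt); nra.
  by have := D1 _ xe3; rewrite expr1 => /le_trans; apply; rewrite ler_wpM2l.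
have Fx : nr (lsubmx (F (p + x))) <= B1 * (t * K) ^+ 2 + B2 * (eps * t).
  rewrite -[lsubmx _](subrK (x *m D)) (le_trans (ler_nrD _ _))// lerD//.
  apply: (le_trans (FD _ (le_lt_trans xK te1))).
  by rewrite ler_wpM2l// lerXn2r ?nnegrE ?nr_ge0// mulr_ge0// ltW.
have xF := Nlow _ (le_lt_trans xK te2) Nx.
have : t * nr v <= t * (BK * t + B0 * B2 * eps + eps).
  apply: (le_trans xlow); rewrite !mulrDr lerD ?[eps * t]mulrC//.
  apply: (le_trans xF); apply: (le_trans (ler_wpM2l B00 Fx)).
  by rewrite le_eqVlt; apply/orP; left; apply/eqP; rewrite /BK; ring.
rewrite ler_pM2l// => vle.
have h1 : 4 * (BK * t) <= nr v by nra.
have h2 : 4 * (B0 * B2 * eps + eps) <= nr v.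
  by apply: le_trans epsv; rewrite le_eqVlt; apply/orP; left; apply/eqP; ring.
lra.
Qed.

(** The lift of the j-th coordinate line has velocity A_j, with all the complex
    multiples of A_j tangent to N; the A_j are independent because D maps A_j to
    the j-th basis vector, as F maps the lift back to the line. *)
Lemma le_dimT01 : (forall b, set_z0 c b = 0) -> finite_germ F p -> (m <= dimT01 N p)%N.
Proof.
move=> c0 finF; have [D FD] := differential_Fz.
have /boolp.choice[A AP] : forall j : 'I_m, exists A : 'rV[C]_(m + 1),
    A *m D = delta_mx 0 j /\ forall a : C, tangent N p (a *: A).
  move=> j; have [A hA nearh] := line_lift (delta_mx 0 j) c0 finF.
  exists A; split; last first.
    by apply: tangent_line hA _; apply: filterS nearh => s [].
  apply/eqP; rewrite eq_sym -subr_eq0; apply/eqP; apply: isO_line_eq0.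
  pose h s := g (graph_point rho (s *: delta_mx 0 j)).
  have h1 : isO 1 (fun s : C => h s - p).
    apply: isO_ext (isO_add (isO_weaken (isT : (1 <= 2)%N) hA) (isO_line A)) => s.
    by rewrite subrK.
  have e1 := isO_comp h1 FD.
  have e3 := isO_mulmxr D hA.
  apply: isO_near (isO_add e1 e3); apply: filterS nearh => s [_ Fh].
  rewrite [p + _]addrC subrK Fh /graph_point row_mxKl.
  by rewrite [(_ - s *: A) *m D]mulmxBl subrKA -scalemxAl scalerBr.
apply: (@dimT01_ge _ _ _ _ _ (\matrix_j A j) D); first by rewrite addn1.
  by apply/row_matrixP => j; rewrite row_mul rowK row1; have [] := AP j.
by move=> j a; rewrite rowK; have [_] := AP j.
Qed.

End lifting.

Unset Implicit Arguments.

(* C^n is 'rV[CC R]_(m + 1) with n = m + 1 >= 2; a point x has coordinates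
   (z, w) = (lsubmx x, rsubmx x 0 0) in C^(n-1) x C. *)
Theorem proposition2p4 (R : realType) (m : nat) (hm : (1 <= m)%N)
    (M : set 'rV[CC R]_(m + 1))
    (rho : 'rV[CC R]_m -> CC R) (c : mpseries (R := R) (m + m))
    (d : nat) (N Omega : set 'rV[CC R]_(m + 1))
    (F : 'rV[CC R]_(m + 1) -> 'rV[CC R]_(m + 1)) :
  analytic_submanifold 2 M ->
  CR_singular M ->
  has_zzbar_series c rho 0 ->
  order_ge c 2 ->
  (\forall x \near (0 : 'rV[CC R]_(m + 1)),
     M x <-> rsubmx x 0 0 = rho (lsubmx x)) ->
  analytic_submanifold d N ->
  generic d N ->
  open Omega ->
  N `<=` Omega ->
  (forall x, Omega x -> forall j, holomorphic_at (fun y => F y 0 j) x) ->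
  diffeomorphism_onto N M F ->
  (forall b, set_z0 c b = 0) ->
  forall p, N p -> F p = 0 -> ~ finite_germ F p.
Proof.
move=> _ _ crho _ Mrho sN gN oO NO Fhol [[NMF _ surjF] _ [G [GF Gsmooth]]] c0 p Np Fp finF.
have M0 : M 0 by rewrite -Fp; exact: NMF.
have [U [g [oU U0 sg gG]]] := Gsmooth 0 M0.
have rho0 : rho 0 = 0.
  have := nbhs_singleton Mrho => -[/(_ M0)].
  by rewrite !linear0 mxE => <-.
have rho1 := zzbar_small crho rho0.
have g0 : g 0 = p by rewrite gG// -Fp GF.
have MNF x : M x -> U x -> N (g x) /\ F (g x) = x.
  move=> Mx Ux; have [y Ny yx] := surjF x Mx.
  by rewrite gG// -yx GF.
have gF x : N x -> U (F x) -> g (F x) = x.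
  by move=> Nx UFx; rewrite gG ?GF//; exact: NMF.
have Fholp j := Fhol p (NO p Np) j.
have dimN := le_dimT01 crho rho1 Mrho Fp Fholp oU U0 sg g0 MNF c0 finF.
have d1 : (d <= 1)%N by rewrite -(leq_add2l m) -(gN p Np) leq_add2r.
have [D FD] := differential_Fz Fp Fholp.
have mn : (m < m + 1)%N by rewrite addn1.
have [w w0 wD] := exists_left_kernel D mn.
have [a a0 tw] := complex_line_tangent sN Np d1 w0.
apply: (no_approx_tangent rho1 Mrho Fp Fholp oU U0 sg g0 NMF gF FD _ _ tw).
  by rewrite scaler_eq0 negb_or a0.
by rewrite -scalemxAl wD scaler0.
Qed.
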